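(* (a) Every finite simplicial complex that admits a tight linear embedding in $\mathbb{R}^3$ is perfect. (b) Every triangulated $3$-manifold that admits a tight linear embedding in some $\mathbb{R}^k$ is perfect.
   Context: Simplicial complexes are finite; a triangulated manifold is a simplicial complex whose underlying space is a manifold, possibly with boundary. Homology is taken with $\mathbb{Z}_2$-coefficients, and $\beta_i$ denotes the $i$-th non-reduced Betti number. Tightness: let $|C|\subset\mathbb{R}^k$ be a linear embedding (geometric realization) of a simplicial complex $C$, and let $\pi\in\mathbb{R}^k$ be a nonzero vector. For an affine hyperplane $h$ orthogonal to $\pi$, let $h^+$ be the open halfspace delimited by $h$ in direction $\pi$. $|C|$ is $\pi$-tight if for every affine hyperplane $h$ orthogonal to $\pi$ and every $i$ the homomorphism $H_i(h^+\cap|C|)\to H_i(|C|)$ induced by inclusion is injective. $|C|$ is tight if it is $\pi$-tight for almost all $\pi$, i.e. for all nonzero $\pi$ outside a set of measure zero. Perfection: a discrete Morse function on $C$ is a weakly increasing map $f$ from the poset of nonempty faces of $C$ (ordered by inclusion) to $\mathbb{Z}$ that is at most $2$-to-$1$. A face $\sigma$ is critical under $f$ if $f$ is strictly increasing at $\sigma$, i.e. there is no face $\tau\neq\sigma$ comparable to $\sigma$ with $f(\tau)=f(\sigma)$. $C$ is perfect if it admits a discrete Morse function that has, for each $i$, exactly $\beta_i(C)$ critical $i$-dimensional faces. *)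

(* Defs.v *)
From HB Require Import structures.
From mathcomp Require Import all_boot all_order all_algebra.
From mathcomp Require Import all_classical all_reals all_analysis.

Set Implicit Arguments.
Unset Strict Implicit.
Unset Printing Implicit Defensive.

Import Order.TTheory GRing.Theory Num.Theory.
Import numFieldNormedType.Exports.

Local Open Scope classical_set_scope.
Local Open Scope ring_scope.

Section Combinatorics.
Variable V : finType.
Implicit Types (C : {set {set V}}) (s t : {set V}).

(* A complex is the set of its nonempty faces.  An element of V need not be a
   vertex of C. *)
Definition simplicial_complex C :=
  finset.set0 \notin C /\
  forall s t, s \in C -> t \subset s -> t != finset.set0 -> t \in C.

(* Indexed by cardinality: the i-dimensional faces are [faces C i.+1]. *)
Definition faces C (m : nat) : {set {set V}} :=
  [set s in C | #|s| == m]%SET.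

(* The i-th boundary matrix over Z_2, acting on row vectors.  For i = 0 it has
   no columns when C is a complex, as set0 is not in C, so the homology is not
   reduced. *)
Definition simplicial_bd C (i : nat) :
    'M['F_2]_(#|faces C i.+1|, #|faces C i|) :=
  \matrix_(a < #|faces C i.+1|, b < #|faces C i|)
    ((enum_val b : {set V}) \subset (enum_val a : {set V}))%:R.

Definition betti C (i : nat) : nat :=
  (\rank (kermx (simplicial_bd C i)) - \rank (simplicial_bd C i.+1))%N.

(* Only the values of f on C matter. *)
Definition discrete_morse C (f : {set V} -> int) :=
  {in C &, forall s t, s \subset t -> f s <= f t} /\
  (forall z : int, (#|[set s in C | f s == z]%SET| <= 2)%N).

Definition critical C (f : {set V} -> int) s :=
  (s \in C) &&
  ~~ [exists t in C,
        [&& t != s, (t \subset s) || (s \subset t) & f t == f s]].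

Definition perfect C :=
  exists f, discrete_morse C f /\
    forall i : nat,
      #|[set s | critical C f s & #|s| == i.+1]%SET| = betti C i.

End Combinatorics.

Section SingularHomology.
Variable R : realType.

Definition std_simplex (n : nat) : set 'rV[R]_n.+1 :=
  [set x | (forall j, 0 <= x 0 j) /\ \sum_j x 0 j = 1].
Arguments std_simplex n : clear implicits.

Definition insert0 n (i : 'I_n.+2) (x : 'rV[R]_n.+1) : 'rV[R]_n.+2 :=
  \row_j (if unlift i j is Some k then x 0 k else 0).

Lemma insert0_simplex n (i : 'I_n.+2) (x : std_simplex n) :
  std_simplex n.+1 (insert0 i (set_val x)).
Proof.
have [x_ge0 x_sum1] := set_valP x; split=> [j|].
  by rewrite mxE; case: unliftP.
rewrite (bigD1_ord i) //= mxE unlift_none add0r -[RHS]x_sum1.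
by apply: eq_bigr => k _; rewrite mxE liftK.
Qed.

Definition coface n (i : 'I_n.+2) (x : std_simplex n) : std_simplex n.+1 :=
  exist _ (insert0 i (set_val x)) (mem_set (insert0_simplex i x)).

Section Chains.
Variable T : topologicalType.

(* The singular chains of a subspace A of T are the finitely supported functions
   on the singular simplices of T with image in A, extended by 0 to all
   (possibly discontinuous) maps std_simplex n -> T. *)
Definition prechain n := (std_simplex n -> T) -> 'F_2.

Definition singular_simplex (A : set T) n : set (std_simplex n -> T) :=
  [set s | continuous s /\ range s `<=` A].

Definition singular_chain (A : set T) n : set (prechain n) :=
  [set c | finite_set [set s | c s != 0] /\
           [set s | c s != 0] `<=` @singular_simplex A n].

(* The coefficient of t in the boundary of c is the sum of c s over all pairs
   (s, i) such that t is the i-th face of s; signs vanish over Z_2. *)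
Definition singular_bd n (c : prechain n.+1) : prechain n :=
  fun t => \sum_(u \in [set u : (std_simplex n.+1 -> T) * 'I_n.+2 |
                          u.1 \o coface u.2 = t]) c u.1.

Definition singular_cycle (A : set T) n : set (prechain n) :=
  [set z | singular_chain A z /\
           match n return prechain n -> Prop with
           | 0 => fun _ => True
           | _.+1 => fun z => singular_bd z = (fun=> 0)
           end z].

Definition singular_boundary (A : set T) n : set (prechain n) :=
  [set singular_bd b | b in @singular_chain A n.+1].

(* For A `<=` X, the map H_n(A) -> H_n(X) induced by inclusion has trivial
   kernel. *)
Definition homology_injective (A X : set T) n :=
  forall z : prechain n,
    singular_cycle A z -> singular_boundary X z -> singular_boundary A z.

End Chains.
End SingularHomology.

Section Geometry.
Variables (R : realType) (V : finType).
Implicit Type C : {set {set V}}.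

(* The underlying space of C, in barycentric coordinates *)
Definition underlying_space C : set {ptws V -> R} :=
  [set w | [/\ forall v, 0 <= w v, \sum_v w v = 1 &
               [set v | w v != 0]%SET \in C]].

(* The extension of p, affine on each face, to the underlying space *)
Definition linear_ext k (p : V -> 'rV[R]_k) (w : {ptws V -> R}) : 'rV[R]_k :=
  \sum_v w v *: p v.

(* The underlying space is compact, so an injective map that is affine on each
   face is a homeomorphism onto its image. *)
Definition linear_embedding C k (p : V -> 'rV[R]_k) :=
  {in underlying_space C &, injective (linear_ext p)}.

Definition embedded_space C k (p : V -> 'rV[R]_k) : set 'rV[R]_k :=
  linear_ext p @` underlying_space C.

Definition dot k (x y : 'rV[R]_k) : R := \sum_j x 0 j * y 0 j.

Definition open_halfspace k (pi : 'rV[R]_k) (a : R) : set 'rV[R]_k :=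
  [set x | a < dot x pi].

Definition dir_tight k (X : set 'rV[R]_k) (pi : 'rV[R]_k) :=
  forall (a : R) (i : nat),
    @homology_injective R _ (open_halfspace pi a `&` X) X i.

(* Lebesgue measure zero in R^k: coverable by countably many boxes of
   arbitrarily small total volume *)
Definition measure_zero k (N : set 'rV[R]_k) :=
  forall e : R, 0 < e ->
    exists (D : pred nat) (a b : nat -> 'rV[R]_k),
      [/\ forall i j, a i 0 j <= b i 0 j,
          N `<=` \bigcup_(i in [set i | D i])
                   [set x | forall j, a i 0 j <= x 0 j <= b i 0 j] &
          (\sum_(i <oo | D i) (\prod_j (b i 0 j - a i 0 j))%:E <= e%:E)%E].

Definition tight k (X : set 'rV[R]_k) :=
  measure_zero [set pi | pi != 0 /\ ~ dir_tight X pi].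

Definition admits_tight_embedding C k :=
  exists p : V -> 'rV[R]_k, linear_embedding C p /\ tight (embedded_space C p).

Definition homeomorphic (S T : topologicalType) (A : set S) (B : set T) :=
  exists (f : S -> T) (g : T -> S),
    [/\ {within A, continuous f}, {within B, continuous g},
        f @` A `<=` B, g @` B `<=` A &
        (forall x, A x -> g (f x) = x) /\ (forall y, B y -> f (g y) = y)].

Definition half_space d : set 'rV[R]_d :=
  [set y | forall j : 'I_d, j = 0%N :> nat -> 0 <= y 0 j].

(* Every point has a neighbourhood homeomorphic to an open subset of the closed
   d-dimensional half-space; Hausdorffness and second countability are automatic
   for a subspace of V -> R with V finite. *)
Definition triangulated_manifold C d :=
  forall x, underlying_space C x ->
    exists (U : set {ptws V -> R}) (W : set 'rV[R]_d),
      [/\ open U, U x, open W &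
          homeomorphic (underlying_space C `&` U) (@half_space d `&` W)].

End Geometry.

(* Main.v *)
From HB Require Import structures.
Require Import Defs.
From mathcomp Require Import all_boot all_order all_algebra.
From mathcomp Require Import all_classical all_reals all_analysis.
From mathcomp Require Import measurable_realfun.
From mathcomp Require Import zify ring lra.

(** Both hypotheses make every point of |C| have a neighbourhood that injects
    continuously into 3-space.  By Borsuk-Ulam, neither a 4-simplex nor three
    tetrahedra around a triangle allow this, so every edge of a vertex link is
    in at most two triangles, and the link has no tetrahedra.

    Sweep C by the height function of a generic tight direction, adding the
    vertices v one by one from the top.  The new faces form the cone over the
    upper link L of v.  Since edges of L are in at most two triangles, L is built
    up from nothing by expansions and critical faces that complete mod 2 cycles:
    downwards, collapse free edges, and when there are none, the sum of all
    triangles is a cycle; the remaining graph has a spanning forest.  Coning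
    these steps builds up C.  A cycle of L bounds its cone in C, hence by
    tightness it bounds among the faces above v, so every critical face of C
    completes a cycle too.  Then each critical face raises one Betti number by
    one, and expansions change none.

    Tightness is a statement on singular homology; it is transferred to
    simplicial chains by simplicial approximation. *)

Set Implicit Arguments.
Unset Strict Implicit.
Unset Printing Implicit Defensive.

Import Order.TTheory GRing.Theory Num.Theory.
Import numFieldNormedType.Exports.

Local Open Scope ring_scope.

(** * Mod 2 chains and discrete Morse functions *)

(** The bound of two triangles per edge is what makes links harmless. A general 2-complex, such as
    the dunce hat, may have no free edge and still no mod 2 cycle of triangles, and then no
    collapsing order is perfect; under the bound, the lack of free edges itself produces a cycle.
    Coning shifts dimensions by one and turns the empty face of a link into the new vertex [v].
    Links are therefore built in reduced homology with the empty face as a genuine face, while [C]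
    is built in unreduced homology, and one predicate with a flag serves both. The coefficients mod
    2 enter in three places: the sum of all triangles is a cycle without any orientability, ordered
    simplices carry no signs, and Borsuk-Ulam reduces to a cup product of sign cochains. *)

Lemma addF2 (x : 'F_2) : x + x = 0.
Proof. by apply/val_inj; case: x => [[|[|]]]. Qed.

Lemma F2_neq0 (x : 'F_2) : x != 0 -> x = 1.
Proof. by case: x => [[|[|]]] //= i _; apply/val_inj. Qed.

Lemma addF2_eq0 (x y : 'F_2) : x + y = 0 -> x = y.
Proof. by move=> xy; rewrite -[x]addr0 -(addF2 y) addrA xy add0r. Qed.

Section Building.
Import boot.fintype boot.finset.
Variable V : finType.
Implicit Types (C : {set {set V}}) (s t : {set V}).

(** Chains are functions on all subsets of [V], the empty one included, so this is the augmented
    boundary; unreduced statements exclude [t = set0] by hand. *)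
Definition bd (c : {set V} -> 'F_2) t : 'F_2 := \sum_(v | v \notin t) c (v |: t).
Definition ind s t : 'F_2 := (t == s)%:R.
Definition supported C m (c : {set V} -> 'F_2) :=
  forall s, c s != 0 -> s \in faces C m.

(* Reversed collapsing sequences.  With [b = true] the empty face counts as a
   face and homology is reduced; with [b = false] it never occurs.  A critical
   face must complete a cycle, which is what makes the sequence perfect. *)
Inductive built (b : bool) : {set {set V}} -> Prop :=
| built0 : built b set0
| built_critical C s c : built b C -> s \notin C ->
    (b || (s != set0)) ->
    (forall t, t \proper s -> b || (t != set0) -> t \in C) ->
    supported C #|s| c ->
    (forall t, b || (t != set0) -> bd c t = bd (ind s) t) ->
    built b (s |: C)
| built_expansion C s x : built b C -> s \notin C -> x \notin s ->
    x |: s \notin C -> b || (s != set0) ->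
    (forall t, t \proper x |: s -> t != s -> b || (t != set0) -> t \in C) ->
    built b (s |: ((x |: s) |: C)).

Lemma bd_ind s t : bd (ind s) t = ((t \subset s) && (#|s| == #|t|.+1))%:R.
Proof.
rewrite /bd /ind; case: andP => [[ts /eqP cs]|nts]; last first.
  rewrite big1 // => v vt; case: eqP => // e; case: nts.
  by rewrite -e finset.subsetUr cardsU1 vt.
have /set0Pn[x] : s :\: t != set0 by rewrite -card_gt0 cardsD (setIidPr ts) cs subSnn.
rewrite inE => /andP[xt xs].
have es : s = x |: t.
  apply/esym/eqP; rewrite eqEcard cardsU1 xt cs add1n leqnn andbT.
  by rewrite subUset sub1set xs.
rewrite (bigD1 x) //= es eqxx big1 ?addr0 // => v /andP[vt vx].
case: eqP => // /setP/(_ v); rewrite !inE eqxx (negPf vt) (negPf vx) //.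
Qed.

Lemma bdD c d t : bd (fun s => c s + d s) t = bd c t + bd d t.
Proof. by rewrite /bd big_split. Qed.

Lemma bd_expand c t : bd c t = \sum_s c s * bd (ind s) t.
Proof.
rewrite /bd /ind.
under [RHS]eq_bigr do rewrite mulr_sumr.
rewrite exchange_big /=; apply: eq_bigr => v _.
by rewrite (bigD1 (v |: t)) //= eqxx mulr1 big1 ?addr0 // => s /negPf; rewrite eq_sym => ->; rewrite mulr0.
Qed.

Lemma bdbd c t : bd (bd c) t = 0.
Proof.
rewrite /bd pair_big_dep /=.
under eq_bigl do rewrite !inE negb_or.
(* The pairs (v, w) and (w, v) remove the same two vertices; comparing ranks splits the ordered
   pairs into two halves that the swap exchanges. *)
rewrite (bigID (fun p => (enum_rank p.1 < enum_rank p.2)%N)) /=.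
set S1 := (X in X + _); rewrite (_ : \sum_(i | _) _ = S1) ?addF2 //.
rewrite {}/S1 (reindex_inj (h := fun p : V * V => (p.2, p.1))) /=; last first.
  by move=> [a b] [c' d] [-> ->].
apply: eq_big => [[a b]|[a b] _] /=; last by rewrite setUCA.
rewrite [b == a]eq_sym; case: (eqVneq a b) => [->|ab] /=; first by rewrite !andbF.
rewrite -leqNgt leq_eqVlt (inj_eq val_inj) (inj_eq enum_rank_inj) (negPf ab).
by case: (a \in t) (b \in t) => [] [].
Qed.

End Building.

(** * Ranks of boundary matrices along a building sequence *)

Section Perfect.
Import boot.fintype boot.finset.
Variable V : finType.
Implicit Types (C : {set {set V}}) (s t : {set V}).

(** Coordinates are indexed by all subsets of [V], so that row spaces of different complexes lie in
    one space. The coordinate of the empty face is cleared because [betti] is unreduced. *)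
Definition bd_row s : 'rV['F_2]_#|{set V}| :=
  \row_j (if enum_val j == set0 then 0 else bd (ind s) (enum_val j)).

Definition bds C m : 'M['F_2]_#|{set V}| :=
  (\sum_(t in faces C m.+1) <<bd_row t>>)%MS.

Definition rbd C m := \rank (bds C m).

Lemma mem_faces C m s : (s \in faces C m) = (s \in C) && (#|s| == m).
Proof. by rewrite inE. Qed.

Lemma rank_simplicial_bd C i : simplicial_complex C ->
  \rank (simplicial_bd C i) = rbd C i.
Proof.
case=> C0 Csub.
(* [E] embeds the space with basis [faces C i] into the space with basis all subsets; it is row
   free, so it preserves ranks. *)
pose E := \matrix_(a < #|faces C i|) delta_mx (0 : 'I_1) (enum_rank (enum_val a : {set V})) : 'M['F_2]_(_, #|{set V}|).
have Efree : row_free E.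
  apply/row_freeP; exists E^T; apply/matrixP => a b; rewrite !mxE.
  rewrite (bigD1 (enum_rank (enum_val a))) //= !mxE !eqxx /= mul1r.
  rewrite big1 => [|j ja]; last by rewrite !mxE eqxx /= (negPf ja) mul0r.
  by rewrite addr0 (inj_eq enum_rank_inj) (inj_eq enum_val_inj).
rewrite -(mxrankMfree _ Efree).
set M := _ *m E.
have rowM a : row a M = bd_row (enum_val a).
  apply/rowP => j; rewrite !mxE bd_ind.
  have /[!mem_faces]/andP[aC /eqP ca] := enum_valP a.
  have rw b : simplicial_bd C i a b * E b j =
      if enum_val j == enum_val b then (enum_val j \subset enum_val a)%:R else 0.
    rewrite !mxE eqxx /= -(inj_eq enum_val_inj) enum_rankK.
    by case: eqP => [->|_]; rewrite ?mulr1 ?mulr0.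
  under eq_bigr do rewrite rw.
  rewrite -big_mkcond /= ca eqSS.
  have [ji|nji] := boolP (enum_val j \in faces C i).
    rewrite (big_pred1 (enum_rank_in ji (enum_val j))) => [|b]; last first.
      by rewrite /= -[RHS](inj_eq enum_val_inj) enum_rankK_in // eq_sym.
    move: ji; rewrite mem_faces => /andP[jC /eqP ->]; rewrite eqxx andbT.
    by case: eqP => // j0; rewrite -j0 jC in C0.
  rewrite big_pred0 => [|b]; last first.
    by apply: contraNF nji => /eqP ->; exact: enum_valP.
  case: eqP => // /eqP j0; case: andP => // -[js /eqP cj].
  by case/negP: nji; rewrite mem_faces cj eqxx andbT (Csub _ _ aC).
rewrite /rbd; apply/eqmx_rank; rewrite (_ : (_ == _)%MS) //; apply/andP; split.
  apply/row_subP => a; rewrite rowM /bds.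
  by apply: (sumsmx_sup (enum_val a)); [exact: enum_valP | rewrite genmxE].
apply/sumsmx_subP => t tC; rewrite genmxE.
by rewrite -(enum_rankK_in tC tC) -rowM row_sub.
Qed.

Lemma betti_rbd C i : simplicial_complex C ->
  betti C i = (#|faces C i.+1| - rbd C i - rbd C i.+1)%N.
Proof. by move=> CC; rewrite /betti mxrank_ker !rank_simplicial_bd. Qed.

Lemma bds_setU1 C m s : s \notin C -> 
  (bds (s |: C) m :=: if #|s| == m.+1 then <<bd_row s>> + bds C m else bds C m)%MS.
Proof.
move=> sC; rewrite /bds; case: eqP => [cs|/eqP cs].
  rewrite (bigD1 s) /= ?mem_faces ?setU11 ?cs ?eqxx //.
  apply: adds_eqmx => //; apply/eqmxP; rewrite (eq_bigl (mem (faces C m.+1))) ?submx_refl //.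
  move=> t /=; rewrite !mem_faces !inE; case: eqVneq => [->|] //=.
    by rewrite (negPf sC) andbF.
  by rewrite andbT.
rewrite (eq_bigl (mem (faces C m.+1))) ?submx_refl // => t /=.
rewrite !mem_faces !inE; case: eqVneq => [->|] //=.
by rewrite (negPf sC) (negPf cs).
Qed.

Lemma bd_row_chain C m c s : supported C m.+1 c ->
  (forall t, t != set0 -> bd c t = bd (ind s) t) -> (bd_row s <= bds C m)%MS.
Proof.
move=> cC bdc.
have -> : bd_row s = \sum_t c t *: bd_row t.
  apply/rowP => j; rewrite summxE !mxE; case: eqP => [j0|/eqP j0].
    by rewrite big1 // => t _; rewrite !mxE j0 eqxx mulr0.
  rewrite -bdc // bd_expand; apply: eq_bigr => t _.
  by rewrite !mxE (negPf j0).
apply: summx_sub => t _; have [->|ct] := eqVneq (c t) 0; first by rewrite scale0r sub0mx.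
by apply/scalemx_sub/(sumsmx_sup t); rewrite ?cC // genmxE.
Qed.

Lemma faces_setU1 C s m : s \notin C ->
  #|faces (s |: C) m| = (#|faces C m| + (#|s| == m))%N.
Proof.
move=> sC; case: eqP => [cs|/eqP cs].
  rewrite (_ : faces _ _ = s |: faces C m); last first.
    by apply/setP => t; rewrite !inE; case: eqVneq => [->|] //=; rewrite cs eqxx.
  by rewrite cardsU1 mem_faces (negPf sC) addnC.
rewrite addn0; congr #|pred_of_set _|; apply/setP => t; rewrite !inE.
by case: eqVneq => [->|] //=; rewrite (negPf sC) (negPf cs).
Qed.

(** The boundary of [s] is that of a chain of [C], so its row already lies in the old row space: the
    new face enlarges the cycles and no rank. *)
Lemma rbd_critical C c s m : supported C #|s| c -> s \notin C ->
  (forall t, t != set0 -> bd c t = bd (ind s) t) -> rbd (s |: C) m = rbd C m.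
Proof.
move=> cC sC bdc; rewrite /rbd (bds_setU1 m sC); case: eqP => // cs.
have /addsmx_idPr -> // : (<<bd_row s>> <= bds C m)%MS.
by rewrite genmxE; apply: (bd_row_chain (c := c)); rewrite -?cs.
Qed.

(** The coordinate of [s] vanishes on the boundary of every face of [C], as none contains [s], but
    equals 1 on that of [t]; hence the row of [t] is independent of the old ones. *)
Lemma rbd_expansion C s t m : s \notin C -> #|s| = m -> s != set0 ->
  {in C, forall u : {set V}, ~~ (s \subset u)} ->
  t \notin s |: C -> s \subset t -> #|t| = m.+1 ->
  rbd (t |: (s |: C)) m = (rbd C m).+1.
Proof.
move=> sC cs s0 Cs tsC st ct.
rewrite /rbd (bds_setU1 m tsC) ct eqxx.
have := bds_setU1 m sC; rewrite cs (ltn_eqF (ltnSn m)) => e.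
have -> : (<<bd_row t>> + bds (s |: C) m :=: bd_row t + bds C m)%MS.
  by apply: adds_eqmx; [exact: genmxE | exact: e].
pose j := enum_rank s.
have tj : bd_row t 0 j = 1 by rewrite mxE enum_rankK (negPf s0) bd_ind st ct cs eqxx.
have Bj (v : 'rV_#|{set V}|) : (v <= bds C m)%MS -> v 0 j = 0.
  have : (bds C m <= kermx (delta_mx j (0 : 'I_1)))%MS.
    apply/sumsmx_subP => u uC; rewrite genmxE; apply/sub_kermxP.
    rewrite -colE; apply/colP => i; rewrite !mxE enum_rankK (negPf s0) bd_ind.
    by move: uC; rewrite mem_faces => /andP[/Cs /negPf-> _].
  move=> BK /submx_trans/(_ BK)/sub_kermxP; rewrite -colE => /colP/(_ 0).
  by rewrite !mxE.
have t0 : bd_row t != 0.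
  by apply: contra_eq_neq tj => ->; rewrite mxE eq_sym oner_eq0.
rewrite mxrank_disjoint_sum; first by rewrite rank_rV t0.
apply/eqP/rowV0P => v; rewrite sub_capmx => /andP[/sub_rVP[a va] /Bj].
by rewrite va mxE tj mulr1 => ->; rewrite scale0r.
Qed.

Definition perfect_upto C (f : {set V} -> int) (n : int) :=
  [/\ discrete_morse C f, {in C, forall s, f s < n} &
    forall i, #|faces C i.+1| =
     (#|faces [set s | critical C f s] i.+1| + rbd C i + rbd C i.+1)%N].

(* The steps of a reversed collapsing sequence are numbered by the Morse
   function: the new faces [N] all get the next value [n]. *)
Section Extension.
Variables (C N : {set {set V}}) (f : {set V} -> int) (n : int).
Hypotheses (CC : simplicial_complex C) (NC : [disjoint N & C]).
Hypotheses (fC : discrete_morse C f) (fn : {in C, forall s, f s < n}).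
Hypotheses (N2 : (#|N| <= 2)%N) (N0 : set0 \notin N).

Let g s := if s \in N then n else f s.

Let gC s : s \in C -> g s = f s.
Proof. by move=> sC; rewrite /g (disjointFl NC). Qed.

Lemma ext_lt : {in N :|: C, forall s, g s < n + 1}.
Proof.
move=> s; rewrite inE /g; case: ifP => [_ _|_ /= /fn]; first by rewrite ltrDl.
by move/lt_trans; apply; rewrite ltrDl.
Qed.

Lemma ext_morse : discrete_morse (N :|: C) g.
Proof.
case: fC => fmono f2; split=> [s t|z].
  rewrite !inE => sNC tNC st.
  have [tN|tN] := boolP (t \in N).
    rewrite {2}/g tN; move: sNC => /orP[sN|sC]; first by rewrite /g sN.
    by rewrite gC // ltW // fn.
  move: tNC; rewrite (negPf tN) /= => tC; rewrite [g t]gC //.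
  have sC : s \in C.
    have [s0|s0] := eqVneq s set0; last exact: CC.2 tC st s0.
    by move: sNC; rewrite s0 (negPf N0).
  by rewrite !gC // fmono.
have [zn|zn] := eqVneq z n.
  apply: leq_trans N2; apply: subset_leq_card; apply/subsetP => s.
  rewrite !inE zn; case/andP => /orP[//|sC]; rewrite gC // => /eqP fsn.
  by have := fn sC; rewrite fsn ltxx.
apply: leq_trans (f2 z); apply: subset_leq_card; apply/subsetP => s.
rewrite !inE => /andP[/orP[sN|sC]]; first by rewrite /g sN eq_sym (negPf zn).
by rewrite gC // sC.
Qed.

Lemma ext_critical s : critical (N :|: C) g s =
  if s \in N then ~~ [exists t in N, (t != s) && ((t \subset s) || (s \subset t))]
  else critical C f s.
Proof.
rewrite /critical inE; case: ifP => sN /=.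
  congr (~~ _); apply/existsP/existsP => -[t]; last first.
    by move=> /and3P[tN ts st]; exists t; rewrite inE tN ts st /g tN sN eqxx.
  rewrite inE => /and4P[tNC ts st gts]; exists t; rewrite ts st !andbT.
  case/orP: tNC => // tC; move: gts; rewrite gC // /g sN => /eqP fsn.
  by have := fn tC; rewrite fsn ltxx.
case sC: (s \in C) => //=; congr (~~ _); apply/existsP/existsP => -[t].
  rewrite inE => /and4P[/orP[tN|tC] ts st].
    by rewrite /g tN sN eq_sym => /eqP fsn; have := fn sC; rewrite fsn ltxx.
  by rewrite !gC // => fts; exists t; rewrite tC ts st fts.
move=> /and4P[tC ts st fts]; exists t.
by rewrite inE tC orbT ts st !gC.
Qed.

End Extension.

Lemma built_perfect_upto C : built false C ->
  simplicial_complex C /\ exists f n, perfect_upto C f n.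
Proof.
elim=> {C} [|C s c _ [CC [f [n [fC fn fcard]]]] sC /= s0 sub cC bdc
           |C s x _ [CC [f [n [fC fn fcard]]]] sC xs xsC /= s0 sub].
- split; first by split=> [|s t]; rewrite inE.
  exists (fun=> 0), 0; split=> [|s|i]; [split=> [s t|z]|..]; rewrite ?inE //.
    by apply: leq_trans (_ : 0 <= 2)%N => //; rewrite leqn0 cards_eq0; apply/eqP/setP => s; rewrite !inE.
  have r0 m : rbd set0 m = 0%N.
    rewrite /rbd /bds big_pred0 ?mxrank0 // => t; rewrite mem_faces inE //.
  rewrite !r0 !addn0; congr #|pred_of_set _|; apply/setP => s.
  by rewrite !mem_faces !inE /critical inE.
- have C'C : simplicial_complex (s |: C).
    split=> [|u t]; first by rewrite !inE negb_or eq_sym s0; case: CC.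
    rewrite !inE => /orP[/eqP->|uC] tu t0; last by rewrite (CC.2 u) ?orbT.
    by case: eqVneq => //= ts; apply: sub; rewrite // properEneq ts.
  split=> //; exists (fun t => if t \in [set s] then n else f t), (n + 1).
  have NC : [disjoint [set s] & C] by rewrite disjoints1.
  have N2 : (#|[set s]| <= 2)%N by rewrite cards1.
  have N0 : set0 \notin [set s] by rewrite inE eq_sym.
  split; [exact: ext_morse|exact: ext_lt|move=> i].
  rewrite (_ : finset _ = s |: [set t | critical C f t]); last first.
    apply/setP => t; rewrite !inE (ext_critical NC fn) inE; case: ifP => //= /eqP ->.
    by apply/existsP => -[u]; rewrite inE; case: eqP.
  rewrite !faces_setU1 ?inE ?/critical ?(negPf sC) //.
  rewrite !(rbd_critical _ cC) // fcard -!addnA; congr addn.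
  by rewrite addnA addnC.
set t := x |: s; have tsC : t \notin s |: C.
  by rewrite !inE negb_or xsC andbT; apply: contraNneq xs => <-; rewrite setU11.
have st : s \subset t by rewrite subsetUr.
have ct : #|t| = #|s|.+1 by rewrite cardsU1 xs.
have t0 : t != set0 by rewrite -card_gt0 ct.
(* The other facets of [t] have the same boundary as [s], so adding [s] changes no rank, as for a
   critical face; [t] then raises the single rank in degree [#|s|]. *)
pose c u := bd (ind t) u + ind s u.
have cC : supported C #|s| c.
  move=> u; rewrite /c bd_ind /ind ct eqSS mem_faces.
  case: (eqVneq u s) => [->|us]; first by rewrite st eqxx addF2 eqxx.
  rewrite addr0; case: andP => [[ut /eqP cu] _|]; last by rewrite eqxx.
  rewrite cu eqxx andbT; apply: sub => //.
    by rewrite properEcard -/t ut ct cu ltnSn.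
  by rewrite -card_gt0 -cu card_gt0.
have bdc u : bd c u = bd (ind s) u by rewrite bdD bdbd add0r.
have C'C : simplicial_complex (s |: (t |: C)).
  split=> [|u w]; first by rewrite !inE !negb_or !(eq_sym set0) s0 t0; case: CC.
  have sC' w' : w' != set0 -> w' \subset t -> w' \in s |: (t |: C).
    move=> w0 wt; rewrite !inE; case: (eqVneq w' s) => //= ws.
    by case: eqVneq => //= wt'; apply: sub; rewrite // properEneq wt'.
  rewrite [in u \in _]inE [in u \in _]inE !inE.
  move=> /or3P[/eqP->|/eqP->|uC] wu w0; last by rewrite (CC.2 u) ?orbT.
    by have := sC' w w0 (subset_trans wu st); rewrite !inE.
  by have := sC' w w0 wu; rewrite !inE.
split=> //.
have NC : [disjoint [set s; t] & C].
  by rewrite disjoint_subset; apply/subsetP => u; rewrite !inE => /orP[]/eqP->.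
have N2 : (#|[set s; t]| <= 2)%N by rewrite cards2; case: (s != t).
have N0 : set0 \notin [set s; t] by rewrite !inE !(eq_sym set0) negb_or s0.
exists (fun u => if u \in [set s; t] then n else f u), (n + 1).
rewrite setUA; split; [exact: ext_morse|exact: ext_lt|move=> i].
rewrite (_ : finset _ = [set t | critical C f t]); last first.
  apply/setP => u; rewrite !inE (ext_critical NC fn); case: ifP => //.
  rewrite !inE => /orP[]/eqP->; rewrite /critical ?(negPf sC) ?(negPf xsC) /=;
    apply/negbTE; rewrite negbK; apply/existsP.
    exists t; rewrite !inE eqxx orbT st orbT andbT.
    by apply: contraNneq tsC => ->; rewrite setU11.
  exists s; rewrite !inE eqxx st /= andbT.
  by apply: contraNneq tsC => <-; rewrite setU11.
rewrite -setUA setUCA !faces_setU1 // ct fcard.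
have rC' j : rbd (t |: (s |: C)) j = (rbd C j + (j == #|s|))%N.
  have [->|jm] := eqVneq j #|s|.
    rewrite (rbd_expansion sC) ?addn1 //.
    by move=> u uC; apply: contraNN sC => su; apply: CC.2 su s0.
  rewrite addn0 /rbd (bds_setU1 _ tsC) ct eqSS eq_sym (negPf jm).
  exact: (rbd_critical _ cC).
rewrite !rC' eqSS ![#|s| == _]eq_sym.
rewrite -!addnA; congr addn; congr addn; rewrite [in RHS]addnCA; congr addn.
by rewrite addnC.
Qed.

Lemma built_perfect C : built false C -> perfect C.
Proof.
move=> /built_perfect_upto[CC [f [n [fC _ fcard]]]]; exists f; split=> // i.
rewrite betti_rbd // fcard -subnDA -addnA addnK.
by congr #|pred_of_set _|; apply/setP => s; rewrite mem_faces !inE.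
Qed.

End Perfect.

(** * Coning a building sequence of the upper link *)

Section Cone.
Import boot.fintype boot.finset.
Variable V : finType.
Implicit Types (C K Y : {set {set V}}) (s t : {set V}) (v : V).

Definition cone v (c : {set V} -> 'F_2) t : 'F_2 := if v \in t then c (t :\ v) else 0.

(** The cone formula: the boundary of [v * c] is [c + v * bd c], for a chain [c] that avoids [v]. *)
Lemma bd_cone v c t : (forall s, v \in s -> c s = 0) ->
  bd (cone v c) t = if v \in t then bd c (t :\ v) else c t.
Proof.
move=> cv; rewrite /bd /cone; case: ifPn => vt.
  rewrite [RHS](bigD1 v) ?inE ?eqxx //= cv ?setU11 // add0r.
  apply: eq_big => [w|w wt].
    by rewrite !inE negb_and negbK; case: eqVneq => [->|] //=; rewrite ?vt ?andbT ?andbF.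
  rewrite inE vt orbT; congr c; apply/setP => u; rewrite !inE.
  by case: (eqVneq u w) => [->|] //=; rewrite andbT; apply: contraNneq wt => ->.
rewrite (bigD1 v) //= setU11 big1 ?addr0 => [|w /andP[wt wv]].
  by congr c; apply/setP => u; rewrite !inE; case: eqVneq => [->|] //=; rewrite (negPf vt).
by rewrite !inE (negPf vt) orbF eq_sym (negPf wv).
Qed.

Lemma cone_ind v s t : v \notin s -> cone v (ind s) t = ind (v |: s) t.
Proof.
move=> vs; rewrite /cone /ind; case: ifPn => vt.
  congr (_ %:R); congr nat_of_bool; apply/eqP/eqP => [<-|->]; first by rewrite setD1K.
  by rewrite setU1K.
by case: eqP => // ts; rewrite ts setU11 in vt.
Qed.

Lemma setU1_inj v s t : v \notin s -> v \notin t -> v |: s = v |: t -> s = t.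
Proof. by move=> vs vt e; rewrite -(setU1K vs) e setU1K. Qed.

Lemma built_closed b C : built b C ->
  forall s t, s \in C -> t \subset s -> b || (t != set0) -> t \in C.
Proof.
elim=> {C} [|C s c _ IH sC s0 sub _ _|C s x _ IH sC xs xsC s0 sub] u t; first by rewrite inE.
  rewrite !inE => /orP[/eqP->|uC] tu t0; last by rewrite (IH u) ?orbT.
  by case: eqVneq => //= ts; apply: sub; rewrite // properEneq ts.
have sC' w : b || (w != set0) -> w \subset x |: s -> w \in s |: ((x |: s) |: C).
  move=> w0 wt; rewrite !inE; case: (eqVneq w s) => //= ws.
  by case: eqVneq => //= wt'; apply: sub; rewrite // properEneq wt'.
rewrite [in u \in _]inE [in u \in _]inE !inE.
move=> /or3P[/eqP->|/eqP->|uC] wu w0; last by rewrite (IH u) ?orbT.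
  by have := sC' t w0 (subset_trans wu (subsetUr _ _)); rewrite !inE.
by have := sC' t w0 wu; rewrite !inE.
Qed.

(* If a critical face [s] of the link completes the cycle [s + c], and [s + c]
   bounds [d] in [K], then [v |: s] has the boundary of [d + v * c]. *)
Lemma built_cone K v Y : built false K -> {in K, forall s : {set V}, v \notin s} ->
  built true Y -> {in Y, forall s : {set V}, v \notin s /\ (s != set0 -> s \in K)} ->
  (forall m z, supported Y m.+1 z -> (forall t, bd z t = 0) ->
     exists2 d, supported K m.+2 d & forall t, bd d t = z t) ->
  built false (K :|: [set v |: s | s in Y]).
Proof.
move=> bK Kv; elim=> {Y} [|Y s c bY IH sY _ sub cY bdc|Y s x bY IH sY xs xsY _ sub] YK H.
- by rewrite imset0 setU0.
- have [vs sK] := YK s (setU11 _ _).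
  have YK' : {in Y, forall s : {set V}, v \notin s /\ (s != set0 -> s \in K)}.
    by move=> u uY; apply: YK; rewrite inE uY orbT.
  have bKY : built false (K :|: [set v |: s | s in Y]).
    apply: IH => // m z zY; apply: H => u /zY; rewrite !mem_faces !inE.
    by case/andP => -> ->; rewrite orbT.
  rewrite imsetU1 setUCA.
  have vsN : v |: s \notin K :|: [set v |: s | s in Y].
    rewrite inE negb_or (contraL (Kv _)) ?setU11 //=.
    by apply/imsetP => -[u uY] /(setU1_inj vs (YK' u uY).1) su; move: sY; rewrite su uY.
  suff [e eS bde] : (exists2 e, supported (K :|: [set v |: s | s in Y]) #|v |: s| e &
      forall t, t != set0 -> bd e t = bd (ind (v |: s)) t).
    apply: (built_critical bKY vsN _ _ eS) => //=.
      by apply/set0Pn; exists v; rewrite setU11.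
    move=> t tp t0; rewrite inE.
    have [vt|vt] := boolP (v \in t).
      apply/orP; right; apply/imsetP; exists (t :\ v); rewrite ?setD1K //.
      apply: sub => //; rewrite properEcard; move: tp; rewrite properEcard => /andP[tvs].
      rewrite cardsU1 vs (cardsD1 v t) vt ltn_add2l => ->; rewrite andbT.
      by rewrite subDset.
    apply/orP; left; have ts : t \subset s.
      apply/subsetP => w wt; move/proper_sub/subsetP: tp => /(_ w wt).
      by rewrite !inE => /orP[/eqP wv|//]; rewrite -wv wt in vt.
    have [->|nts] := eqVneq t s; last by apply: (YK' t _).2 => //; apply: sub; rewrite // properEneq nts.
    apply: sK; by apply: contraNneq t0 => s0; rewrite s0 subset0 in ts.
  rewrite cardsU1 vs add1n.
  (* The cone over the empty face is the vertex [v], whose unreduced boundary is zero, so the zero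
     chain completes it. *)
  have [s0|s0] := eqVneq s set0.
    exists (fun=> 0) => [u|t t0]; first by rewrite eqxx.
    rewrite /bd big1 // -/(bd _ _) bd_ind s0 setU0 cards1 eqSS [0%N == _]eq_sym cards_eq0 (negPf t0) andbF //.
  pose z u := c u + ind s u.
  have cv (u : {set V}) : v \in u -> c u = 0.
    move=> vu; apply/eqP; apply: contraLR vu => /cY; rewrite mem_faces => /andP[/YK' []//].
  have zv (u : {set V}) : v \in u -> z u = 0.
    move=> vu; rewrite /z cv // add0r /ind; case: eqP => // us.
    by rewrite us (negPf vs) in vu.
  have bz t : bd z t = 0 by rewrite bdD bdc // addF2.
  have sm : #|s| = #|s|.-1.+1 by rewrite prednK // card_gt0.
  (* The only use of tightness: the cycle [z] of the link bounds in [K]. *)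
  have [|d dK bdd] := H #|s|.-1 z _ bz.
    move=> u; rewrite -sm /z mem_faces !inE; have [->|us] /= := eqVneq u s; first by rewrite eqxx.
    by rewrite /ind (negPf us) addr0 => /cY; rewrite mem_faces.
  exists (fun u => d u + cone v c u) => [u|t t0].
    rewrite mem_faces inE; have [du|/dK] := eqVneq (d u) 0; last first.
      by rewrite -sm mem_faces => /andP[-> ->].
    rewrite du add0r /cone; case: ifP => vu; last by rewrite eqxx.
    move=> /cY; rewrite mem_faces => /andP[uY /eqP cu].
    by rewrite (cardsD1 v u) vu cu add1n eqxx andbT; apply/orP; right; apply/imsetP; exists (u :\ v); rewrite ?setD1K.
  apply: addF2_eq0; rewrite bdD bdd.
  have -> : bd (ind (v |: s)) t = bd (cone v (ind s)) t.
    by apply: eq_bigr => w _; rewrite cone_ind.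
  rewrite -addrA -bdD.
  have -> : bd (fun u => cone v c u + cone v (ind s) u) t = bd (cone v z) t.
    by apply: eq_bigr => w _; rewrite /cone; case: ifP; rewrite ?addr0.
  rewrite bd_cone //; case: ifP => vt; last exact: addF2.
  by rewrite zv // add0r bz.
- have YK' : {in Y, forall s : {set V}, v \notin s /\ (s != set0 -> s \in K)}.
    by move=> u uY; apply: YK; rewrite !inE uY !orbT.
  have bKY : built false (K :|: [set v |: s | s in Y]).
    apply: IH => // m z zY; apply: H => u /zY; rewrite !mem_faces !inE.
    by case/andP => -> ->; rewrite !orbT.
  have [vs sK] := YK s (setU11 _ _).
  have [vxs xsK] : v \notin x |: s /\ (x |: s != set0 -> x |: s \in K).
    by apply: YK; rewrite !inE eqxx orbT.
  have vsN (u : {set V}) : v \notin u -> u \notin Y -> v |: u \notin K :|: [set v |: s | s in Y].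
    move=> vu uY; rewrite inE negb_or (contraL (Kv _)) ?setU11 //=.
    by apply/imsetP => -[w wY] /(setU1_inj vu (YK' w wY).1) su; move: uY; rewrite su wY.
  rewrite !imsetU1 !(setUCA K).
  have vx : x != v by apply: contraNneq vxs => ->; rewrite setU11.
  have e : v |: (x |: s) = x |: (v |: s) by rewrite setUCA.
  rewrite e.
  apply: built_expansion => //.
  + exact: vsN.
  + by rewrite !inE negb_or vx.
  + by rewrite -e; apply: vsN.
  + by apply/set0Pn; exists v; rewrite setU11.
  rewrite -e => t tp tvs /= t0; rewrite inE.
  have [vt|vt] := boolP (v \in t).
    apply/orP; right; apply/imsetP; exists (t :\ v); rewrite ?setD1K //.
    apply: sub => //; last by apply: contraNneq tvs => <-; rewrite setD1K.
    rewrite properEcard; move: tp; rewrite properEcard => /andP[tvs'].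
    by rewrite cardsU1 vxs (cardsD1 v t) vt ltn_add2l => ->; rewrite andbT subDset.
  apply/orP; left; have ts : t \subset x |: s.
    apply/subsetP => w wt; move/proper_sub/subsetP: tp => /(_ w wt).
    by rewrite in_setU1 => /orP[/eqP wv|//]; rewrite -wv wt in vt.
  have [->|nts] := eqVneq t (x |: s).
    by apply: xsK; apply/set0Pn; exists x; rewrite setU11.
  have [ts'|nts'] := eqVneq t s; first by rewrite ts' in t0 *; apply: sK.
  by apply: (YK' t _).2 => //; apply: sub; rewrite // properEneq nts.
Qed.

End Cone.

Section Surface.
Import boot.fintype boot.finset.
Variable V : finType.
Implicit Types (C X Y : {set {set V}}) (s t : {set V}) (u v x y : V).

(** * Links of vertices and the sweep *)

(** Unlike in [simplicial_complex], a nonempty [Y] contains the empty face, which links need. *)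
Definition subset_closed Y := forall s t, s \in Y -> t \subset s -> t \in Y.

(** Homologous vertices stand in for an edge path: [c] is exactly the chain that [built_critical]
    asks for when an edge from [x] to [y] is added. *)
Definition joined Y x y :=
  exists2 c, supported Y 2 c & forall t, bd c t = ind [set x] t + ind [set y] t.

Lemma joined_refl Y x : joined Y x x.
Proof.
exists (fun=> 0) => [s|t]; first by rewrite eqxx.
by rewrite addF2 /bd big1.
Qed.

Lemma joined_sym Y x y : joined Y x y -> joined Y y x.
Proof. by case=> c cY bdc; exists c => // t; rewrite addrC. Qed.

Lemma supportedD Y m c d : supported Y m c -> supported Y m d ->
  supported Y m (fun s => c s + d s).
Proof.
move=> cY dY s; have [cs|/cY //] := eqVneq (c s) 0.
by rewrite cs add0r; apply: dY.
Qed.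

Lemma joined_trans Y x y z : joined Y x y -> joined Y y z -> joined Y x z.
Proof.
case=> c cY bdc [d dY bdd]; exists (fun s => c s + d s); first exact: supportedD.
by move=> t; rewrite bdD bdc bdd -addrA (addrA (ind [set y] t)) addF2 add0r.
Qed.

Lemma supported_sub X Y m c : X \subset Y -> supported X m c -> supported Y m c.
Proof.
by move=> XY cX s /cX; rewrite !mem_faces => /andP[/(subsetP XY)-> ->].
Qed.

Lemma joined_sub X Y x y : X \subset Y -> joined X x y -> joined Y x y.
Proof. by move=> XY [c cX bdc]; exists c => //; apply: supported_sub cX. Qed.

Lemma bd_edge x y t : x != y -> bd (ind [set x; y]) t = ind [set x] t + ind [set y] t.
Proof.
move=> xy; rewrite bd_ind cards2 xy eqSS /ind.
have [->|tx] := eqVneq t [set x].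
  by rewrite sub1set !inE eqxx cards1 (inj_eq set1_inj) (negPf xy) addr0.
have [->|ty] := eqVneq t [set y].
  by rewrite sub1set !inE eqxx orbT cards1 add0r.
rewrite addr0; case: andP => // -[txy]; rewrite eq_sym => /cards1P[z tz].
move: txy tx ty; rewrite tz sub1set !inE => /orP[]/eqP->; by rewrite eqxx.
Qed.

Lemma joined_edge Y x y : x != y -> [set x; y] \in Y -> joined Y x y.
Proof.
move=> xy xyY; exists (ind [set x; y]) => [s|t]; last exact: bd_edge.
by rewrite /ind mem_faces; case: (eqVneq s [set x; y]) => [->|]; rewrite ?cards2 ?xy ?xyY ?eqxx.
Qed.

Lemma bd_supported0 Y m c t : supported Y m c -> #|t|.+1 != m -> bd c t = 0.
Proof.
move=> cY tm; rewrite /bd big1 // => v vt; apply/eqP; apply: contraNT tm => /cY.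
by rewrite mem_faces cardsU1 vt => /andP[].
Qed.

Section Graph.
Variable Y : {set {set V}}.
Hypotheses (Ycl : subset_closed Y) (Y2 : {in Y, forall s, (#|s| <= 2)%N}).

(** By the last clause, vertices of [X] in one component of [Y] are already in one component of [X],
    so an edge of [Y] left between them closes a cycle. *)
Definition spanned X :=
  [/\ built true X, X \subset Y, set0 \in X, exists u, [set u] \in X &
      forall x y, [set x] \in X -> [set y] \in X -> joined Y x y -> joined X x y].

Lemma cardsP2 s : s \in Y -> [\/ s = set0, exists x, s = [set x] | exists x y, x != y /\ s = [set x; y]].
Proof.
move=> sY; have := Y2 sY; case c : #|s| => [|[|[|]]] // _.
- by constructor 1; apply: cards0_eq.
- by constructor 2; apply/cards1P/eqP.
- by constructor 3; have /eqP/cards2P[x [y [xy ->]]] := c; exists x, y.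
Qed.

(* Grow [X] one edge at a time, starting a new component only when no edge of
   [Y] leaves [X]; edges between joined vertices come last. *)
Lemma spanned_built X : spanned X -> built true Y.
Proof.
have [n] := ubnP #|Y :\: X|; elim: n X => // n IHn X; rewrite ltnS => cX SX.
have [bX XY X0 [u uX] jX] := SX.
have [YX|/subsetPn[s0 s0Y s0X]] := boolP (Y \subset X).
  by rewrite (_ : Y = X) //; apply/eqP; rewrite eqEsubset YX.
have grow X' : X \proper X' -> spanned X' -> built true Y.
  move=> XX' SX'; apply: (IHn X') => //; apply: leq_trans cX.
  have [_ X'Y _ _ _] := SX'; rewrite !cardsD !(setIidPr _) //.
  have := proper_card XX'; have := subset_leq_card X'Y; lia.
have [/existsP[x /existsP[y /and4P[xyY xX yX xy]]]|noedge] := boolP [exists x, exists y,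
    [&& [set x; y] \in Y, [set x] \in X, [set y] \notin X & x != y]].
  have xyX : x |: [set y] \notin X.
    by apply: contraNN yX => /(built_closed bX); apply=> //; rewrite subsetUr.
  pose X' := [set y] |: ((x |: [set y]) |: X).
  have XX' : X \subset X' by rewrite /X' setUA subsetUr.
  have X'1 z : [set z] \in X' -> z = y \/ [set z] \in X.
    rewrite !inE (inj_eq set1_inj) => /or3P[/eqP|/eqP/(congr1 (fun A : {set V} => #|A|))|]; [by left| |by right].
    by rewrite cards1 cards2 xy.
  have xyX' : joined X' x y by apply: joined_edge; rewrite // !inE eqxx orbT.
  have yY : [set y] \in Y by apply: Ycl xyY _; rewrite subsetUr.
  apply: (grow X').
    by rewrite properE XX'; apply/subsetPn; exists [set y]; rewrite // !inE eqxx.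
  split.
  - apply: built_expansion; rewrite // ?inE // => t.
    rewrite properE => /andP[txy nxyt] ty _.
    have tY : t \in Y by apply: Ycl xyY _.
    case: (cardsP2 tY) => [->//|[z tz]|[z [w [zw tzw]]]].
      move: txy ty; rewrite tz sub1set !inE => /orP[/eqP->//|/eqP->]; by rewrite eqxx.
    case/negP: nxyt; suff -> : x |: [set y] = t by [].
    by apply/esym/eqP; rewrite eqEcard txy tzw !cards2 xy zw.
  - by rewrite !subUset !sub1set yY xyY.
  - exact: (subsetP XX').
  - by exists u; apply: (subsetP XX').
  - have jy w : [set w] \in X -> joined Y w y -> joined X' w y.
      move=> wX wy; apply: joined_trans (xyX'); apply: joined_sub XX' _; apply: jX => //.
      by apply: joined_trans wy _; apply/joined_sym/joined_edge.
    move=> z w /X'1[->|zX] /X'1[->|wX] zw; first exact: joined_refl.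
    + by apply/joined_sym/jy => //; apply: joined_sym.
    + exact: jy.
    + by apply: joined_sub XX' _; apply: jX.
have stay x y : [set x; y] \in Y -> [set x] \in X -> [set y] \in X.
  move=> xyY xX; have [<-//|xy] := eqVneq x y; apply: contraNT noedge => yX.
  by apply/existsP; exists x; apply/existsP; exists y; rewrite xyY xX yX.
have [/existsP[y /andP[yY yX]]|novertex] := boolP [exists y, ([set y] \in Y) && ([set y] \notin X)].
  pose X' := [set y] |: X.
  have XX' : X \subset X' by rewrite subsetUr.
  have X'1 z : [set z] \in X' -> z = y \/ [set z] \in X.
    by rewrite !inE (inj_eq set1_inj) => /orP[/eqP|]; [left|right].
  have far w : [set w] \in X -> ~ joined Y w y.
    move=> wX [c cY bdc].
    (* No edge of [Y] leaves [X], so the part of [c] on edges that meet [X] has boundary [w] alone.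
       Its augmentation is 1, against [bdbd]. *)
    pose c' s := if [exists z in s, [set z] \in X] then c s else 0.
    have bdc' z : bd c' [set z] = (z == w)%:R.
      have [zX|zX] := boolP ([set z] \in X).
        have -> : bd c' [set z] = bd c [set z].
          apply: eq_bigr => v _; rewrite /c'; case: existsP => // -[]; exists z.
          by rewrite !inE eqxx orbT.
        rewrite bdc /ind !(inj_eq set1_inj) [z == y]negbTE ?addr0 //.
        by apply: contraNneq yX => <-.
      rewrite [z == w]negbTE; last by apply: contraNneq zX => ->.
      rewrite /bd big1 // => v vz; rewrite /c'; case: existsP => // -[z' /andP[]].
      have [//|/cY] := eqVneq (c (v |: [set z])) 0; rewrite mem_faces => /andP[vzY _].
      rewrite !inE => /orP[]/eqP->; last by rewrite (negPf zX).
      by move=> vX; rewrite (stay v z) in zX.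
    have := bdbd c' set0; rewrite {1}/bd.
    under eq_bigl do rewrite inE.
    under eq_bigr do rewrite setU0 bdc'.
    by rewrite (bigD1 w) //= eqxx big1 => [/eqP//|z /negPf->].
  apply: (grow X').
    by rewrite properE XX'; apply/subsetPn; exists [set y]; rewrite // !inE eqxx.
  split.
  (* In reduced homology a new component is a critical vertex that completes the 0-cycle [y + u]. *)
  - apply: (built_critical (c := ind [set u]) bX yX) => //.
    + move=> t /properP[]; rewrite subset1 => /orP[/eqP->|/eqP->] // [z]; by rewrite inE => ->.
    + move=> t; rewrite cards1 /ind mem_faces; case: (eqVneq t [set u]) => [->|]; rewrite ?cards1 ?uX ?eqxx //.
    + move=> t _; rewrite !bd_ind !cards1 !eqSS; congr (nat_of_bool _)%:R.
      rewrite ![0%N == _]eq_sym !cards_eq0; case: eqP => [->|]; rewrite ?sub0set ?andbF //.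
  - by rewrite subUset sub1set yY.
  - exact: (subsetP XX').
  - by exists u; apply: (subsetP XX').
  - move=> z w /X'1[->|zX] /X'1[->|wX] zw; first exact: joined_refl.
    + by case: (far _ wX); apply: joined_sym.
    + by case: (far _ zX).
    + by apply: joined_sub XX' _; apply: jX.
have vX y : [set y] \in Y -> [set y] \in X.
  by move=> yY; apply: contraNT novertex => yX; apply/existsP; exists y; rewrite yY.
case: (cardsP2 s0Y) => [s00|[x s0x]|[x [y [xy s0xy]]]].
- by rewrite s00 X0 in s0X.
- by rewrite s0x vX -?s0x in s0X.
have xX : [set x] \in X by apply: vX; apply: Ycl s0Y _; rewrite s0xy subsetUl.
have yX : [set y] \in X by apply: vX; apply: Ycl s0Y _; rewrite s0xy subsetUr.
have [|c cX' bdc] := jX x y xX yX; first by apply: joined_edge; rewrite // -s0xy.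
have XX' : X \subset s0 |: X by rewrite subsetUr.
apply: (grow (s0 |: X)).
  by rewrite properE XX'; apply/subsetPn; exists s0; rewrite // !inE eqxx.
split.
- apply: (built_critical (c := c) bX s0X) => //.
  + move=> t; rewrite properEcard => /andP[ts0 ct] _.
    case: (cardsP2 (Ycl s0Y ts0)) => [->//|[z tz]|[z [w [zw tzw]]]].
      by rewrite tz; apply: vX; rewrite -tz; apply: Ycl ts0.
    by move: ct; rewrite tzw s0xy !cards2 xy zw.
  + by rewrite s0xy cards2 xy.
  + by move=> t _; rewrite s0xy bd_edge.
- by rewrite subUset sub1set s0Y.
- exact: (subsetP XX').
- by exists u; apply: (subsetP XX').
- have X'1 z : [set z] \in s0 |: X -> [set z] \in X.
    rewrite !inE => /orP[/eqP/(congr1 (fun A : {set V} => #|A|))|//].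
    by rewrite s0xy cards1 cards2 xy.
  by move=> z w /X'1 zX /X'1 wX zw; apply: joined_sub XX' _; apply: jX.
Qed.

Lemma built_zero : built true [set set0 : {set V}].
Proof.
rewrite -[[set _]]setU0.
apply: (built_critical (c := fun=> 0) (built0 _ _)); rewrite ?inE //.
  by move=> t; rewrite properE subset0 => /andP[/eqP->]; rewrite sub0set.
by move=> t _; rewrite bd_ind cards0 andbF /bd big1.
Qed.

Lemma built_graph : built true Y.
Proof.
have [->|/set0Pn[s0 s0Y]] := eqVneq Y set0; first exact: built0.
have Y0 : set0 \in Y by apply: Ycl s0Y (sub0set _).
have [/existsP[u uY]|nov] := boolP [exists u, [set u] \in Y].
  apply: (@spanned_built (set0 |: ((u |: set0) |: set0))); split.
  (* The empty face is paired with [u], the root of the first tree. *)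
  - apply: built_expansion; rewrite ?inE //; first exact: built0.
    move=> t; rewrite setU0 properE subset1 => /andP[/orP[/eqP->|/eqP->]]; last by rewrite eqxx.
    by rewrite subxx.
  - by rewrite !setU0 subUset !sub1set Y0.
  - by rewrite !inE eqxx.
  - by exists u; rewrite !inE setU0 eqxx orbT.
  - have e z : [set z] \in set0 |: ((u |: set0) |: set0) -> z = u.
      rewrite !inE !setU0 orbF => /orP[/eqP/setP/(_ z)|/eqP/set1_inj //]; by rewrite !inE eqxx.
    by move=> x y /e-> /e-> _; apply: joined_refl.
suff -> : Y = [set set0] by exact: built_zero.
apply/eqP; rewrite eqEsubset sub1set Y0 andbT; apply/subsetP => s sY; rewrite inE.
apply: contraNT nov => /set0Pn[x xs]; apply/existsP; exists x.
by apply: Ycl sY _; rewrite sub1set.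
Qed.

End Graph.

(* A triangle with a free edge can be collapsed.  If there is none, every edge
   is in 0 or 2 triangles, so the sum of all triangles is a cycle mod 2 and any
   triangle can be removed as a critical face. *)
Lemma built_surface Y : subset_closed Y -> {in Y, forall s, (#|s| <= 3)%N} ->
  {in faces Y 2, forall e : {set V}, (#|[set t in faces Y 3 | e \subset t]| <= 2)%N} ->
  built true Y.
Proof.
have [n] := ubnP #|faces Y 3|; elim: n Y => // n IHn Y; rewrite ltnS => cY Ycl Y3 Ye.
have [Y30|/set0Pn[t0 t03]] := eqVneq (faces Y 3) set0.
  apply: built_graph => // s sY; have := Y3 s sY; rewrite leq_eqVlt => /orP[cs|//].
  have : s \in faces Y 3 by rewrite mem_faces sY.
  by rewrite Y30 inE.
have Ye' Y' : Y' \subset Y -> {in faces Y' 2, forall e : {set V}, (#|[set t in faces Y' 3 | e \subset t]| <= 2)%N}.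
  move=> Y'Y e; rewrite mem_faces => /andP[eY' ce].
  apply: leq_trans (Ye e _); last by rewrite mem_faces (subsetP Y'Y).
  apply: subset_leq_card; apply/subsetP => t; rewrite !inE => /andP[/andP[tY' ->] ->].
  by rewrite (subsetP Y'Y).
have smaller Y' t : Y' \subset Y -> t \in faces Y 3 -> t \notin Y' -> (#|faces Y' 3| < n)%N.
  move=> Y'Y tY tY'; apply: leq_trans cY; apply: proper_card; rewrite properE.
  apply/andP; split; last by apply/subsetPn; exists t => //; rewrite mem_faces (negPf tY').
  by apply/subsetP => s; rewrite !mem_faces => /andP[/(subsetP Y'Y)-> ->].
have [/existsP[e /andP[e2 /cards1P[t et]]]|noedge] :=
    boolP [exists e in faces Y 2, #|[set t in faces Y 3 | e \subset t]| == 1%N].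
  have : t \in [set t in faces Y 3 | e \subset t] by rewrite et inE.
  rewrite inE => /andP[t3 est].
  move: (e2) (t3); rewrite !mem_faces => /andP[eY /eqP ce] /andP[tY /eqP ct].
  have eonly (u : {set V}) : u \in Y -> e \subset u -> u = e \/ u = t.
    move=> uY eu; have := Y3 u uY; rewrite leq_eqVlt => /orP[cu|cu].
      right; have : u \in [set t in faces Y 3 | e \subset t] by rewrite inE mem_faces uY cu.
      by rewrite et inE => /eqP.
    by left; apply/esym/eqP; rewrite eqEcard eu ce -ltnS.
  have tonly (u : {set V}) : u \in Y -> t \subset u -> u = t.
    by move=> uY tu; apply/esym/eqP; rewrite eqEcard tu ct Y3.
  have [x xt xe] : exists2 x, x \in t & x \notin e.
    by apply/subsetPn; apply: contraTN isT => te; have := subset_leq_card te; rewrite ce ct.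
  have txe : x |: e = t.
    by apply/eqP; rewrite eqEcard subUset sub1set xt est cardsU1 xe ce ct.
  pose Y' := Y :\: [set e; t].
  have Y'Y : Y' \subset Y by rewrite subsetDl.
  have -> : Y = e |: ((x |: e) |: Y').
    apply/setP => u; rewrite !inE txe; case: (eqVneq u e) => [->|] //=.
    by case: (eqVneq u t) => [->|].
  apply: built_expansion => //; rewrite ?inE ?txe ?eqxx ?orbT //.
    apply: IHn => //.
    - by apply: (smaller _ t) => //; rewrite !inE eqxx orbT.
    - move=> u w; rewrite !inE negb_or => /andP[/andP[ue ut] uY] wu.
      rewrite (Ycl u) // andbT negb_or; apply/andP; split.
        apply/eqP => we; have eu : e \subset u by rewrite -we.
        by case: (eonly u uY eu) => uE; [rewrite uE eqxx in ue | rewrite uE eqxx in ut].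
      by apply: contraNneq ut => wt; apply/eqP/tonly; rewrite // -wt.
    - by move=> s /(subsetP Y'Y) /Y3.
    - exact: Ye'.
  move=> u; rewrite properE => /andP[ut tu] ue _; rewrite !inE negb_or ue (Ycl t) // andbT.
  by apply: contraNneq tu => ->.
pose Y' := Y :\ t0.
have Y'Y : Y' \subset Y by rewrite subsetDl.
have := t03; rewrite mem_faces => /andP[t0Y /eqP ct0].
rewrite -(setD1K t0Y).
apply: (built_critical (c := fun s => ((s \in Y') && (#|s| == 3))%:R)) => //.
- apply: IHn => //.
  + by apply: (smaller _ t0); rewrite // !inE eqxx.
  + move=> u w; rewrite !inE => /andP[ut uY] wu; rewrite (Ycl u) // andbT.
    apply: contraNneq ut => wt; rewrite eq_sym eqEcard -wt wu wt ct0 Y3 //.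
  + by move=> s /(subsetP Y'Y) /Y3.
  + exact: Ye'.
- by rewrite !inE eqxx.
- by move=> u; rewrite properEneq !inE => /andP[-> ut] _; apply: Ycl ut.
- by move=> s; rewrite ct0 mem_faces; case: andP => // _; rewrite eqxx.
move=> e _; apply: addF2_eq0; rewrite -bdD.
have -> : bd (fun s => ((s \in Y') && (#|s| == 3))%:R + ind t0 s) e = bd (fun s => (s \in faces Y 3)%:R) e.
  apply: eq_bigr => v _; rewrite mem_faces /ind !inE; case: eqVneq => [->|] /=; last by rewrite addr0.
  by rewrite t0Y ct0 add0r.
have [ce|ce] := eqVneq #|e| 2; last first.
  apply: (@bd_supported0 Y 3); rewrite ?eqSS // => s.
  by case: (s \in faces Y 3) => //; rewrite eqxx.
have -> : bd (fun s => (s \in faces Y 3)%:R) e = #|[set t in faces Y 3 | e \subset t]|%:R.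
  rewrite bd_expand -sum1_card natr_sum [RHS](eq_bigl (fun t => (t \in faces Y 3) && (e \subset t))); last by move=> t; rewrite inE.
  rewrite big_mkcond [RHS]big_mkcond; apply: eq_bigr => s _; rewrite bd_ind ce mem_faces.
  by case: (s \in Y); case: (#|s| == 3%N); case: (e \subset s); rewrite /= ?mul1r ?mul0r ?mulr0.
have [eY|eY] := boolP (e \in Y); last first.
  rewrite (_ : [set t in _ | _] = set0) ?cards0 //; apply/setP => t; rewrite !inE.
  by apply: contraNF eY => /andP[/andP[tY _] et]; apply: Ycl tY et.
have e2 : e \in faces Y 2 by rewrite mem_faces eY ce.
have := Ye e e2; case c : #|_| => [|[|[|]]] // _; last by apply/val_inj.
by case/negP: noedge; apply/existsP; exists e; rewrite e2 c.
Qed.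

End Surface.

(** * Sweeping the complex from its highest vertex down *)

Section Sweep.
Import boot.fintype boot.finset.
Variable V : finType.
Implicit Types (C X Y : {set {set V}}) (s t : {set V}) (u v x y : V).

Definition superlevel (R : realType) C (h : V -> R) (a : R) : {set {set V}} :=
  [set s in C | [forall v in s, a < h v]].

(** Injectivity of the map from the [m]-th homology of [K] to that of [C], on simplicial chains. The
    cycle condition skips the empty face, as homology is unreduced. *)
Definition cycles_bound K C :=
  forall m z b, supported K m.+1 z -> (forall t, t != set0 -> bd z t = 0) ->
    supported C m.+2 b -> (forall t, bd b t = z t) ->
    exists2 d, supported K m.+2 d & forall t, bd d t = z t.

(** Removing a vertex [v] from the faces that contain it, this says that the link of [v] has
    dimension at most 2 and at most two triangles on each edge. *)
Definition surface_links C :=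
  {in C, forall s, (#|s| <= 4)%N} /\
  {in faces C 3, forall s : {set V}, (#|[set t in faces C 4 | s \subset t]| <= 2)%N}.

Lemma tight_perfect (R : realType) C (h : V -> R) :
  simplicial_complex C -> surface_links C ->
  (forall u v, [set u] \in C -> [set v] \in C -> h u = h v -> u = v) ->
  (forall a, cycles_bound (superlevel C h a) C) -> perfect C.
Proof.
move=> [C0 Ccl] [C4 C3] hinj tightC.
pose W := [set u | [set u] \in C].
pose up (S : {set V}) := forall u w, u \in W -> w \in S -> h w < h u -> u \in S.
suff H (S : {set V}) : S \subset W -> up S -> built false [set s in C | s \subset S].
  apply: built_perfect; have -> : C = [set s in C | s \subset W].
    apply/setP => s; rewrite !inE; case sC: (s \in C) => //=; apply/esym/subsetP => u us.
    rewrite inE (Ccl s) ?sub1set //; by apply/set0Pn; exists u; rewrite inE.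
  by apply: H.
have [n] := ubnP #|S|; elim: n S => // n IHn S; rewrite ltnS => cS SW upS.
have [->|/set0Pn[v0 v0S]] := eqVneq S set0.
  rewrite (_ : [set s in C | _] = set0); first exact: built0.
  by apply/setP => s; rewrite !inE subset0; apply: contraNF C0 => /andP[sC /eqP <-].
pose v := [arg min_(u < v0 in S) h u]%O.
have [vS vmin] : v \in S /\ {in S, forall u, h v <= h u}.
  by rewrite /v; case: arg_minP.
have vW : v \in W by apply: (subsetP SW).
have hv u : u \in S :\ v -> h v < h u.
  rewrite !inE => /andP[uv uS]; rewrite lt_neqAle vmin // andbT.
  apply: contraNneq uv => /hinj vu; rewrite vu //.
    by move: vW; rewrite inE.
  by have := subsetP SW _ uS; rewrite inE.
have S'W : S :\ v \subset W by apply: subset_trans (subsetDl _ _) SW.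
have upS' : up (S :\ v).
  move=> u w uW wS huw; rewrite !inE; have := wS; rewrite !inE => /andP[_ wS'].
  rewrite (upS u w) // andbT; apply: contraTneq huw => ->.
  by rewrite -leNgt ltW // hv.
have bK := IHn (S :\ v) _ S'W upS'.
(* As [h] is injective on vertices and [v] is the lowest of [S], the faces swept before [v] are
   those strictly above height [h v], where tightness applies. *)
have KE : [set s in C | s \subset S :\ v] = superlevel C h (h v).
  apply/setP => s; rewrite !inE; case sC: (s \in C) => //=.
  apply/subsetP/forallP => [sS u|sv u us]; first by apply/implyP => /sS /hv.
  have hvu := implyP (sv u) us; have uW : u \in W.
    by rewrite inE (Ccl s) ?sub1set //; apply/set0Pn; exists u; rewrite inE.
  rewrite !inE (upS u v) // andbT; by apply: contraTneq hvu => ->; rewrite ltxx.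
pose L := [set s : {set V} | [&& v \notin s, v |: s \in C & s \subset S]].
have Lcl : subset_closed L.
  move=> s t; rewrite !inE => /and3P[vs vsC sS] ts.
  rewrite (contraNN (subsetP ts v) vs) (subset_trans ts sS) andbT /=.
  apply: Ccl vsC _ _; first by rewrite setUS.
  by apply/set0Pn; exists v; rewrite setU11.
have L3 : {in L, forall s, (#|s| <= 3)%N}.
  move=> s; rewrite inE => /and3P[vs /C4 + _]; by rewrite cardsU1 vs.
have Le : {in faces L 2, forall e : {set V}, (#|[set t in faces L 3 | e \subset t]| <= 2)%N}.
  move=> e; rewrite mem_faces inE => /andP[/and3P[ve veC _] /eqP ce].
  have ve3 : v |: e \in faces C 3 by rewrite mem_faces veC cardsU1 ve ce.
  apply: leq_trans (C3 _ ve3).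
  rewrite -(card_in_imset (f := fun t => v |: t)); last first.
    move=> t t'; rewrite !inE => /andP[/andP[/and3P[vt _ _] _] _] /andP[/andP[/and3P[vt' _ _] _] _].
    exact: setU1_inj.
  apply: subset_leq_card; apply/subsetP => _ /imsetP[t + ->].
  rewrite !inE => /andP[/andP[/and3P[vt vtC _] /eqP ct] et].
  by rewrite vtC cardsU1 vt ct setUS.
have bL : built true L by apply: built_surface.
have LK : {in L, forall s : {set V}, v \notin s /\ (s != set0 -> s \in [set s in C | s \subset S :\ v])}.
  move=> s; rewrite !inE => /and3P[vs vsC sS]; split=> // s0.
  rewrite (Ccl _ _ vsC) ?subsetUr //=; apply/subsetP => u us; rewrite !inE (subsetP sS) // andbT.
  by apply: contraNneq vs => <-.
have := @built_cone _ _ v L (bK _) _ bL LK.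
rewrite (_ : _ :|: _ = [set s in C | s \subset S]); last first.
  apply/setP => s; rewrite !inE; apply/orP/idP => [[/andP[-> sS]|/imsetP[t + ->]]|/andP[sC sS]].
  - by rewrite (subset_trans sS (subsetDl _ _)).
  - by rewrite inE => /and3P[_ -> tS]; rewrite subUset sub1set vS.
  have [vs|vs] := boolP (v \in s); [right|left].
    apply/imsetP; exists (s :\ v); rewrite ?setD1K // !inE eqxx /= setD1K // sC.
    exact: subset_trans (subsetDl _ _) sS.
  by rewrite sC; apply/subsetP => u us; rewrite !inE (subsetP sS) // andbT; apply: contraNneq vs => <-.
apply.
- by apply: leq_trans cS; rewrite [leqRHS](cardsD1 v) vS.
- move=> s; rewrite !inE => /andP[_ sS]; apply/negP => /(subsetP sS); by rewrite !inE eqxx.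
move=> m z zL bz; rewrite KE.
have zv s : v \in s -> z s = 0.
  move=> vs; apply/eqP; apply: contraTT vs => /zL; rewrite mem_faces inE.
  by case/andP => /andP[].
apply: (tightC (h v) m z (cone v z)) => [s /zL| |s|t].
- rewrite !mem_faces -KE => /andP[sL cs]; rewrite cs andbT (LK s sL).2 //.
  by rewrite -card_gt0 (eqP cs).
- by move=> t _.
- rewrite /cone; case: ifP => vs; last by rewrite eqxx.
  move=> /zL; rewrite !mem_faces inE setD1K // => /andP[/and3P[_ -> _] /eqP cs].
  by rewrite /= (cardsD1 v s) vs cs add1n eqxx.
by rewrite bd_cone //; case: ifP => vt //; rewrite bz zv.
Qed.

End Sweep.

(** * Barycentric subdivision of ordered simplices *)

Section OrderedChains.
Variable T : Type.
Implicit Types (F G : seq T -> 'F_2) (l : seq T).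

(* Ordered simplices are lists and chains are lists of lists, compared mod 2 by
   summing an arbitrary [F] over them.  Chains are augmented: the only facet of
   a point is the empty simplex. *)
Fixpoint facets (U : Type) (l : seq U) : seq (seq U) :=
  if l is x :: l' then l' :: [seq x :: w | w <- facets l'] else [::].

(** The cochain [F] evaluated on the boundary of [l], that is, the coboundary of [F]. *)
Definition dl F l := \sum_(w <- facets l) F w.

Lemma dl_cons F x l : dl F (x :: l) = F l + dl (fun w => F (x :: w)) l.
Proof. by rewrite /dl big_cons big_map. Qed.

Lemma dlD F G l : dl (fun w => F w + G w) l = dl F l + dl G l.
Proof. exact: big_split. Qed.

Lemma dldl F l : dl (dl F) l = 0.
Proof.
elim: l F => [|x l IH] F; first by rewrite /dl big_nil.
rewrite dl_cons (_ : dl (fun w => dl F (x :: w)) l = dl F l + dl (dl (fun w => F (x :: w))) l); last first.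
  by rewrite -dlD; apply: eq_bigr => w _; rewrite dl_cons.
by rewrite IH addr0 addF2.
Qed.

End OrderedChains.

Lemma facets_map (T U : Type) (f : T -> U) l :
  facets (map f l) = map (map f) (facets l).
Proof. by elim: l => //= x l ->; rewrite -!map_comp. Qed.

Lemma facetsP (T : eqType) (l w : seq T) : w \in facets l ->
  size l = (size w).+1 /\ {subset w <= l}.
Proof.
elim: l w => //= x l IH w; rewrite inE => /orP[/eqP->|/mapP[u /IH[su ul] ->]].
  by split=> // y; rewrite inE orbC => ->.
by rewrite su; split=> // y; rewrite !inE => /orP[->|/ul->]; rewrite ?orbT.
Qed.

Section Barycentric.
Variables (R : realType) (E : normedModType R).
Implicit Types (F G : seq E -> 'F_2) (l u w : seq E) (Q : E -> Prop).

Definition bary l : E := (size l)%:R^-1 *: \sum_(x <- l) x.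

(** Closure under barycenters is the form of convexity that passes from a simplex to all vertices of
    its subdivisions. *)
Definition bconvex Q := forall l, l != [::] -> {in l, forall x, Q x} -> Q (bary l).

(* [n] is the size of [l]; the barycenter of [l] is coned to its subdivided facets. *)
Fixpoint sd n l : seq (seq E) :=
  if n is n'.+1 then [seq bary l :: u | u <- flatten [seq sd n' w | w <- facets l]]
  else [:: l].

Fixpoint sdk k n l : seq (seq E) :=
  if k is k'.+1 then flatten [seq sdk k' n u | u <- sd n l] else [:: l].

Lemma sum_flatten_map (I J : Type) (s : seq I) (t : I -> seq J) (F : J -> 'F_2) :
  \sum_(u <- flatten [seq t i | i <- s]) F u = \sum_(i <- s) \sum_(u <- t i) F u.
Proof.
elim: s => [|i s IH] /=; first by rewrite !big_nil.
by rewrite big_cat IH big_cons.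
Qed.

Lemma sum_sdS F n l : \sum_(u <- sd n.+1 l) F u =
  \sum_(w <- facets l) \sum_(u <- sd n w) F (bary l :: u).
Proof. by rewrite /= big_map sum_flatten_map. Qed.

(** The facets through [bary l] come from the subdivided double boundary of [l] and cancel by
    [dldl]; what remains is the subdivision of the boundary. *)
Lemma sd_chain F n l : size l = n.+1 ->
  \sum_(u <- sd n.+1 l) dl F u = \sum_(w <- facets l) \sum_(u <- sd n w) F u.
Proof.
elim: n F l => [|n IH] F l sl; rewrite sum_sdS.
  by case: l sl => [|x []] // _; rewrite !big_seq1 dl_cons /dl big_nil addr0.
under eq_bigr do (under eq_bigr do rewrite dl_cons; rewrite big_split).
rewrite big_split /= [X in _ + X](_ : _ = 0) ?addr0 //.
rewrite -[RHS](dldl (fun w => \sum_(u <- sd n w) F (bary l :: u)) l).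
apply: eq_big_seq => w /facetsP[sw _]; apply: IH.
by apply: succn_inj; rewrite -sl -sw.
Qed.

Lemma sdP n l u : size l = n -> u \in sd n l ->
  size u = n /\ forall Q, bconvex Q -> {in l, forall x, Q x} -> {in u, forall x, Q x}.
Proof.
elim: n l u => [|n IH] l u sl; first by rewrite inE => /eqP->.
move=> /mapP[v /flattenP[_ /mapP[w wl ->] vw] ->].
have [sw wsl] := facetsP wl.
have [|sv vQ] := IH w v _ vw; first by apply: succn_inj; rewrite -sl -sw.
split=> [|Q cQ lQ x]; first by rewrite /= sv.
rewrite inE => /orP[/eqP->|xv]; first by apply: cQ => //; rewrite -size_eq0 sl.
by apply: (vQ Q) xv => // y /wsl /lQ.
Qed.

Lemma sdkP k n l u : size l = n -> u \in sdk k n l ->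
  size u = n /\ forall Q, bconvex Q -> {in l, forall x, Q x} -> {in u, forall x, Q x}.
Proof.
elim: k l => [|k IH] l sl; first by rewrite inE => /eqP->.
move=> /flattenP[_ /mapP[w wl ->] uw].
have [sw wQ] := sdP sl wl; have [su uQ] := IH w sw uw.
by split=> // Q cQ lQ; apply: uQ => //; apply: wQ.
Qed.

Lemma sdk_chain F k n l : size l = n.+1 ->
  \sum_(u <- sdk k n.+1 l) dl F u = \sum_(w <- facets l) \sum_(u <- sdk k n w) F u.
Proof.
elim: k l => [|k IH] l sl.
  by rewrite big_seq1; apply: eq_bigr => w _; rewrite big_seq1.
rewrite /= -/sd sum_flatten_map.
under [RHS]eq_bigr do rewrite sum_flatten_map.
rewrite -sd_chain //; apply: eq_big_seq => u /(sdP sl)[su _].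
exact: IH.
Qed.

Lemma bconvex_ball (b : E) r : bconvex (fun y => `|b - y| <= r).
Proof.
move=> l l0 lQ; have s0 : (0 : R) < (size l)%:R by rewrite ltr0n lt0n size_eq0.
have -> : b - bary l = (size l)%:R^-1 *: \sum_(x <- l) (b - x).
  rewrite sumrB scalerBr; congr (_ - _).
  by rewrite big_const_seq count_predT iter_addr_0 -[b *+ _]scaler_nat scalerA mulVf ?scale1r ?gt_eqF.
rewrite normrZ ger0_norm ?invr_ge0 ?ler0n // ler_pdivrMl // mulrC.
apply: le_trans (ler_norm_sum _ _ _) _.
rewrite big_seq; apply: le_trans (ler_sum _ lQ) _.
by rewrite -big_seq big_const_seq count_predT iter_addr_0 mulr_natr.
Qed.

(** The difference [bary l - x] averages [y - x] over the [n.+1] points of [l], and the term [y = x]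
    vanishes: this gives the factor n/(n+1). The uniform [N] keeps one factor through the recursion
    on facets. *)
Lemma sd_mesh (N : nat) (d : R) n l u : size l = n -> (n <= N.+1)%N -> 0 <= d ->
  {in l &, forall x y, `|x - y| <= d} -> u \in sd n l ->
  {in u &, forall x y, `|x - y| <= N%:R / N.+1%:R * d}.
Proof.
elim: n l u => [|n IH] l u sl nN d0 ld.
  by rewrite inE => /eqP->; move/size0nil: sl => ->.
set q := N%:R / N.+1%:R.
have q0 : 0 <= q * d by rewrite mulr_ge0 // divr_ge0.
move=> /mapP[v /flattenP[_ /mapP[w wl ->] vw] ->].
have [sw wsl] := facetsP wl.
have sw' : size w = n by apply: succn_inj; rewrite -sl -sw.
have bl : {in l, forall x, `|bary l - x| <= q * d}.
  move=> x xl; have s0 : (0 : R) < n.+1%:R by rewrite ltr0n.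
  have -> : bary l - x = n.+1%:R^-1 *: \sum_(y <- l) (y - x).
    rewrite sumrB scalerBr /bary sl; congr (_ - _).
    by rewrite big_const_seq count_predT iter_addr_0 sl -[x *+ _]scaler_nat scalerA mulVf ?scale1r ?gt_eqF.
  rewrite normrZ ger0_norm ?invr_ge0 ?ler0n // (perm_big _ (perm_to_rem xl)) /= big_cons subrr add0r.
  apply: (@le_trans _ _ (n.+1%:R^-1 * (n%:R * d))).
    rewrite ler_wpM2l ?invr_ge0 ?ler0n //; apply: le_trans (ler_norm_sum _ _ _) _.
    have : size (rem x l) = n by rewrite size_rem // sl.
    move: (rem x l) (@mem_rem _ x l) => r rl sr.
    rewrite big_seq; apply: le_trans (ler_sum _ (_ : forall y, y \in r -> _ <= d)) _.
      by move=> y /rl yl; apply: ld.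
    by rewrite -big_seq big_const_seq count_predT iter_addr_0 sr mulr_natl.
  rewrite mulrA ler_wpM2r // mulrC /q ler_pdivrMr // mulrAC ler_pdivlMr //.
  by rewrite -!natrM ler_nat; move: nN; nia.
have vl : {in v, forall x, `|bary l - x| <= q * d}.
  by apply: (sdP sw' vw).2; [exact: bconvex_ball | move=> y /wsl /bl].
have vd : {in v &, forall x y, `|x - y| <= q * d}.
  apply: (IH w v) => //; first exact: ltnW.
  by move=> x y /wsl xl /wsl yl; apply: ld.
move=> x y; rewrite !inE => /orP[/eqP->|xv] /orP[/eqP->|yv].
- by rewrite subrr normr0.
- exact: vl.
- by rewrite distrC; apply: vl.
- exact: vd.
Qed.

Lemma sdk_mesh (N : nat) (d : R) k n l u : size l = n -> (n <= N.+1)%N -> 0 <= d ->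
  {in l &, forall x y, `|x - y| <= d} -> u \in sdk k n l ->
  {in u &, forall x y, `|x - y| <= (N%:R / N.+1%:R) ^+ k * d}.
Proof.
move=> sl nN; elim: k d l sl => [|k IH] d l sl d0 ld.
  by rewrite inE => /eqP->; rewrite expr0 mul1r.
move=> /flattenP[_ /mapP[w wl ->] uw]; rewrite exprSr -mulrA.
apply: (IH _ w) uw; first exact: (sdP sl wl).1.
  by rewrite mulr_ge0 // divr_ge0.
exact: sd_mesh wl.
Qed.

Lemma sdk_small n (d e : R) : 0 <= d -> 0 < e -> exists k, forall l u, size l = n ->
  {in l &, forall x y, `|x - y| <= d} -> u \in sdk k n l ->
  {in u &, forall x y, `|x - y| < e}.
Proof.
move=> d0 e0.
have q1 : `|n%:R / n.+1%:R : R| < 1.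
  by rewrite ger0_norm ?divr_ge0 // ltr_pdivrMr ?ltr0n // mul1r ltr_nat.
(* The denominator is [d + 1] because [d] may be 0. *)
have /cvgrPdist_lt/(_ (e / (d + 1))) := cvg_expr q1.
rewrite divr_gt0 ?ltr_wpDl // => /(_ isT)[k _ /(_ k (leqnn k)) /=].
rewrite sub0r normrN ger0_norm ?exprn_ge0 ?divr_ge0 // => qk.
exists k => l u sl ld uk x y xu yu.
apply: le_lt_trans (sdk_mesh sl (leqnSn n) d0 ld uk xu yu) _.
move: qk; rewrite ltr_pdivlMr ?ltr_wpDl // => qk; apply: le_lt_trans qk.
by rewrite ler_wpM2l ?exprn_ge0 ?divr_ge0 // lerDl.
Qed.

Lemma sdk_nil k l : sdk k 0 l = [:: l].
Proof. by elim: k l => //= k IH l; rewrite IH. Qed.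

Lemma bary_scalar (f : E -> R) l : scalar f ->
  f (bary l) = (size l)%:R^-1 * \sum_(x <- l) f x.
Proof.
move=> lf; pose g : {scalar E} := HB.pack f (GRing.isLinear.Build _ _ _ _ _ lf).
by rewrite /bary -[f]/(g : E -> R) linearZ_LR; congr (_ * _); rewrite linear_sum.
Qed.

Lemma bconvex_ge0 (f : E -> R) : scalar f -> bconvex (fun x => 0 <= f x).
Proof.
move=> lf l l0 lQ; rewrite bary_scalar // mulr_ge0 ?invr_ge0 //.
by rewrite big_seq sumr_ge0.
Qed.

Lemma bconvex_eq (f : E -> R) c : scalar f -> bconvex (fun x => f x = c).
Proof.
move=> lf l l0 lQ; rewrite bary_scalar // big_seq (eq_bigr (fun=> c)) //.
rewrite -big_seq big_const_seq count_predT iter_addr_0 -[c *+ _]mulr_natl mulrA mulVf ?mul1r //.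
by rewrite pnatr_eq0 size_eq0.
Qed.

End Barycentric.

Section Naturality.
Variables (R : realType) (E E' : normedModType R) (f : {linear E -> E'}).

Lemma bary_map l : bary (map f l) = f (bary l).
Proof. by rewrite /bary size_map big_map [RHS]linearZ_LR; congr (_ *: _); rewrite linear_sum. Qed.

Lemma sd_map n l : sd n (map f l) = map (map f) (sd n l).
Proof.
elim: n l => //= n IH l; rewrite facets_map bary_map -!map_comp.
rewrite !map_flatten -!map_comp; congr flatten; apply/eq_map => w /=.
by rewrite IH -!map_comp; apply/eq_map => u /=.
Qed.

Lemma sdk_map k n l : sdk k n (map f l) = map (map f) (sdk k n l).
Proof.
elim: k l => //= k IH l; rewrite sd_map map_flatten -!map_comp; congr flatten.
by apply: eq_map => u /=.
Qed.

End Naturality.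

(** * Labelled ordered simplices as unordered chains *)

Section Labels.
Import boot.fintype boot.finset.
Variable V : finType.
Implicit Types (l : seq V) (t : {set V}).

(** A list with a repeated label is degenerate and gives the zero chain. *)
Definition spans l t : 'F_2 := (uniq l && ([set:: l] == t))%:R.

Lemma spans_cons x l t : spans (x :: l) t = if x \in t then spans l (t :\ x) else 0.
Proof.
rewrite /spans set_cons /=; case: ifPn => xt; last first.
  by case: eqP; rewrite ?andbF // => e; rewrite -e setU11 in xt.
congr (nat_of_bool _)%:R; apply/andP/andP => [[/andP[xl ul] /eqP <-]|[ul /eqP e]].
  by split=> //; rewrite setU1K // inE.
have xl : x \notin l by have := setD11 x t; rewrite -e inE => /negbT.
by rewrite xl ul e setD1K.
Qed.

(** Forgetting the order is a chain map: if a label repeats, the facets that are not degenerate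
    agree in pairs and cancel mod 2. *)
Lemma dl_spans l t : dl (fun w => spans w t) l = bd (spans l) t.
Proof.
elim: l t => [|x l IH] t.
  rewrite /dl big_nil /bd big1 // => v _; rewrite /spans /=.
  case: eqP => // /setP/(_ v); by rewrite !inE eqxx.
rewrite dl_cons /bd; under [RHS]eq_bigr do rewrite spans_cons.
rewrite /dl; under [X in _ + X]eq_bigr do rewrite spans_cons.
have [xt|xt] := boolP (x \in t).
  rewrite -/(dl _ l) IH /bd (bigD1 x) ?inE ?eqxx //= setD1K // addrA addF2 add0r.
  apply: eq_big => [v|v vt].
    by rewrite !inE negb_and negbK; case: eqVneq => [->|] //=; rewrite ?xt ?andbT ?andbF.
  rewrite inE xt orbT; congr spans; apply/setP => u; rewrite !inE.
  by case: (eqVneq u v) => [->|] //=; rewrite andbT; case/andP: vt => _ ->.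
rewrite big1 // addr0 (bigD1 x) //= setU11 setU1K // big1 ?addr0 // => v /andP[vt vx].
by rewrite !inE eq_sym (negPf vx) (negPf xt).
Qed.

Lemma spans_neq0 l t : spans l t != 0 -> #|t| = size l /\ {in t, forall v, v \in l}.
Proof.
rewrite /spans; case: andP => [[ul /eqP <-] _|]; last by rewrite eqxx.
by split=> [|v]; [rewrite cardsE; apply/card_uniqP | rewrite inE].
Qed.

End Labels.

Section Lebesgue.
Variables (R : realType) (E : normedModType R).
Local Open Scope classical_set_scope.

(** The Lebesgue number lemma with predicates in place of open sets; it also yields uniform
    continuity on a compact set. *)
Lemma lebesgue_number (K : set E) (I : Type) (P : I -> E -> Prop) : compact K ->
  (forall x, K x -> exists i r, 0 < r /\ forall y, K y -> `|x - y| < r -> P i y) ->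
  exists2 e : R, 0 < e & forall x, K x -> exists i, forall y, K y -> `|x - y| < e -> P i y.
Proof.
move=> /compact_near_coveringP cK cov.
have := cK R (0^'+) (fun e x => exists i, forall y, K y -> `|x - y| < e -> P i y) _.
move=> /(_ _)[x /cov[i [r [r0 Pr]]]|e /= e0 He].
  near=> x' e.
  have xx' : `|x - x'| < r / 2.
    by near: x'; apply: (@cvgr_dist_lt _ _ _ (nbhs x)); rewrite ?divr_gt0.
  have er : e < r / 2 by near: e; apply: nbhs_right_lt; exact: divr_gt0.
  exists i => y Ky x'y; apply: Pr => //.
  rewrite -(subrKA x') (splitr r); apply: le_lt_trans (ler_normD _ _) (ltrD _ _) => //.
  exact: lt_trans er.
exists (e / 2); first exact: divr_gt0.
by apply: (He (e/2)); rewrite /= ?divr_gt0 // sub0r normrN ger0_norm ?divr_ge0 ?ltW // ltr_pdivrMr // ltr_pMr // ltr1n.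
Unshelve. all: by end_near.
Qed.
End Lebesgue.

(** * The Borsuk-Ulam theorem *)

Section Cup.
Variable T : Type.
Implicit Types (x : T -> 'F_2) (xs : seq (T -> 'F_2)) (l : seq T).

(* The cup product of the coboundaries of the 0-cochains [xs]. *)
Fixpoint cup xs l : 'F_2 :=
  match xs, l with
  | [::], [:: _] => 1
  | x :: xs', p :: (q :: _) as l' => (x p + x q) * cup xs' l'
  | _, _ => 0
  end.

(** A primitive of [cup (x :: xs)]: the first factor is [x] itself instead of its coboundary. *)
Definition xcup x xs l : 'F_2 := if l is p :: _ then x p * cup xs l else 0.

Lemma dl_cup_xcup xs : (forall l, size l = (size xs).+2 -> dl (cup xs) l = 0) ->
  forall x l, size l = (size xs).+2 -> dl (xcup x xs) l = cup (x :: xs) l.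
Proof.
move=> dcup x [//|p [//|q l]] sl; rewrite dl_cons.
have := dcup _ sl; rewrite dl_cons => /addF2_eq0 e.
have -> : dl (fun w => xcup x xs (p :: w)) (q :: l) = x p * cup xs (q :: l).
  by rewrite e /dl mulr_sumr.
by rewrite /= addrC mulrDl.
Qed.

(** For nonempty lists the cup product is the coboundary of [xcup], and a coboundary is closed by
    [dldl]. *)
Lemma dl_cup xs l : size l = (size xs).+2 -> dl (cup xs) l = 0.
Proof.
elim: xs l => [|x xs IH] l sl.
  by case: l sl => [|p [|q []]] // _; rewrite !dl_cons /dl big_nil /= addr0 addF2.
suff e w : size w = (size xs).+2 -> cup (x :: xs) w = dl (xcup x xs) w.
  have dlE F G : (forall w, size w = (size xs).+2 -> F w = G w) -> dl F l = dl G l.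
    clear e IH => FG; have {sl} : size l = (size (size xs :: [::])  + (size xs).+2)%N by rewrite sl.
    rewrite add1n; move: (size xs).+2 FG => n.
    elim: n l F G => [|n IHn] [//|p l] F G FG [sl].
      case: l sl => // _; rewrite !dl_cons /dl !big_nil FG //.
    rewrite !dl_cons FG // (IHn l _ (fun w => G (p :: w))) // => w sw.
    by apply: FG; rewrite /= sw.
  by rewrite (dlE _ _ e) dldl.
by move=> sw; rewrite dl_cup_xcup.
Qed.

Lemma dl_xcup x xs l : size l = (size xs).+2 -> dl (xcup x xs) l = cup (x :: xs) l.
Proof. by apply: dl_cup_xcup => w; exact: dl_cup. Qed.

Lemma cup_const xs l i : (i < size xs)%N -> (size l = (size xs).+1) ->
  (forall p q, List.In p l -> List.In q l -> nth (fun=> 0) xs i p = nth (fun=> 0) xs i q) ->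
  cup xs l = 0.
Proof.
elim: xs l i => [//|x xs IH] [//|p [//|q l]] [|i] /= ixs [sl] e.
  by rewrite (e p q) ?addF2 ?mul0r //; auto.
rewrite (IH (q :: l) i) ?mulr0 //=; first by rewrite sl.
by move=> p' q' p'l q'l; apply: e; auto.
Qed.

End Cup.

Lemma cvg_bigsum (T I : Type) (F : set_system T) (FF : Filter F)
    (K : numFieldType) (W : pseudoMetricNormedZmodType K)
    (r : seq I) (f : I -> T -> W) (a : I -> W) :
  (forall i, (f i x @[x --> F] --> a i)%classic) ->
  (\sum_(i <- r) f i x @[x --> F] --> \sum_(i <- r) a i)%classic.
Proof.
move=> fa; elim: r => [|i r IH].
  by rewrite big_nil; under eq_fun do rewrite big_nil; exact: cvg_cst.
by rewrite big_cons; under eq_fun do rewrite big_cons; exact: cvgD.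
Qed.

Section BorsukUlam.
Variable (R : realType) (n : nat).
Local Notation E := ('rV[R]_n.+1).
Implicit Types (p q : E) (l u v : seq E).
Local Open Scope classical_set_scope.

(** The unit sphere of the l1 norm, that is, the boundary of the cross-polytope. Its triangulation
    is antipodal, and subdividing its straight simplices stays on it. *)
Definition cross_sphere : set E := [set p | \sum_j `|p 0 j| = 1].

Lemma cross_sphere_norm p : cross_sphere p -> `|p| <= 1.
Proof.
move=> /= sp; rewrite [`|p|]mx_normrE; apply: bigmax_le => // -[i j] _ /=.
by rewrite -sp (bigD1 j) //= ord1 lerDl sumr_ge0.
Qed.

Lemma compact_cross_sphere : compact cross_sphere.
Proof.
apply: bounded_closed_compact.
  by exists 1; split=> // x x1 p /cross_sphere_norm/le_trans; apply; exact: ltW.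
have -> : cross_sphere = (fun p => \sum_j `|p 0 j|) @^-1` [set 1] by [].
apply: preimage_closed; last exact: (@closed_eq R 1).
move=> p _; apply: (@cvg_bigsum _ _ (nbhs p) (nbhs_filter p)) => j.
apply: (@continuous_comp _ _ _ (fun p : E => p 0 j) (fun x : R => `|x|)).
  exact: coord_continuous.
exact: norm_continuous.
Qed.

Let e i : E := delta_mx 0 (inord i).

(* [hemi i] is an i-dimensional hemisphere of the boundary of the cross-polytope:
   the boundary of [hemi i.+1] is [hemi i] plus its antipode. *)
Fixpoint hemi i : seq (seq E) :=
  if i is i'.+1 then [seq e i :: u | u <- hemi i' ++ map (map -%R) (hemi i')] else [:: [:: e 0]].

Lemma sum_hemiS (F : seq E -> 'F_2) i : \sum_(v <- hemi i.+1) F v =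
  \sum_(u <- hemi i) (F (e i.+1 :: u) + F (e i.+1 :: map -%R u)).
Proof. by rewrite /= big_map big_cat big_map /= -big_split. Qed.

Lemma dl_map (T U : Type) (f : T -> U) (F : seq U -> 'F_2) (l : seq T) :
  dl F (map f l) = dl (fun w => F (map f w)) l.
Proof. by rewrite /dl facets_map big_map. Qed.

Lemma map_oppK l : map -%R (map -%R l) = l.
Proof. by rewrite -map_comp (eq_map (@opprK _)) map_id. Qed.

Lemma dl_hemi F i : \sum_(v <- hemi i.+1) dl F v = \sum_(u <- hemi i) (F u + F (map -%R u)).
Proof.
elim: i F => [|i IH] F.
  rewrite sum_hemiS /= !big_cons !big_nil !dl_cons /dl !big_nil !addr0.
  by rewrite addrACA addF2 addr0.
rewrite (sum_hemiS _ i.+1).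
under [LHS]eq_bigr do rewrite !dl_cons addrACA.
rewrite big_split /= [X in _ + X](_ : _ = 0) ?addr0 //.
rewrite big_split /= IH; under [X in _ + X]eq_bigr do rewrite dl_map.
rewrite IH; under [X in _ + X]eq_bigr do rewrite map_oppK addrC.
exact: addF2.
Qed.

(** The closed facet of the cross-polytope with sign vector [s]; absolute values become linear on
    it, so it is convex. *)
Definition orthant (s : 'I_n.+1 -> bool) p :=
  (forall j, 0 <= (-1) ^+ s j * p 0 j) /\ \sum_j (-1) ^+ s j * p 0 j = 1.

Lemma orthant_sphere s p : orthant s p -> cross_sphere p.
Proof.
case=> p0 p1; rewrite /cross_sphere /= -[RHS]p1; apply: eq_bigr => j _.
by rewrite -[RHS]ger0_norm // normrM normrX normrN1 expr1n mul1r.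
Qed.

Lemma bconvex_orthant s : bconvex (orthant s).
Proof.
move=> l l0 lQ; split=> [j|].
  apply: (@bconvex_ge0 _ _ (fun p : E => (-1) ^+ s j * p 0 j)) => // [a p q|p /lQ[]//].
  by rewrite !mxE mulrDr mulrCA.
apply: (@bconvex_eq _ _ (fun p : E => \sum_j (-1) ^+ s j * p 0 j)) => // [a p q|p /lQ[]//].
rewrite mulr_sumr -big_split /=; apply: eq_bigr => j _.
by rewrite !mxE mulrDr mulrCA.
Qed.

Lemma hemiP i v : (i <= n)%N -> v \in hemi i -> size v = i.+1 /\
  exists s, {in v, forall p, orthant s p /\ forall j : 'I_n.+1, (i < j)%N -> p 0 j = 0}.
Proof.
have e_sub m (s : _ -> bool) (j : 'I_n.+1) : (-1) ^+ s j * e m 0 j = (if j == inord m then (-1) ^+ s j else 0) :> R.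
  by rewrite mxE eqxx /=; case: eqP => _; rewrite ?mulr1 ?mulr0.
have e_orth m (s : 'I_n.+1 -> bool) : s (inord m) = false -> orthant s (e m).
  move=> sm; split=> [j|].
    by rewrite e_sub; case: eqP => // ->; rewrite sm.
  under eq_bigr do rewrite e_sub.
  by rewrite (bigD1 (inord m)) //= eqxx sm big1 ?addr0 // => j /negPf->.
have e_far m (j : 'I_n.+1) : (m <= n)%N -> (m < j)%N -> e m 0 j = 0.
  move=> mn mj; rewrite mxE eqxx /=; case: eqP => // jm.
  by move: mj; rewrite jm inordK // ltnn.
elim: i v => [|i IH] v iN.
  rewrite inE => /eqP->; split=> //; exists (fun=> false) => p; rewrite inE => /eqP->.
  by split; [exact: e_orth | move=> j; exact: e_far].
have key u s : size u = i.+1 -> {in u, forall p, orthant s p /\ forall j : 'I_n.+1, (i < j)%N -> p 0 j = 0} ->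
    size (e i.+1 :: u) = i.+2 /\
    exists s, {in e i.+1 :: u, forall p, orthant s p /\ forall j : 'I_n.+1, (i.+1 < j)%N -> p 0 j = 0}.
  move=> su us; split; first by rewrite /= su.
  (* The new vertex is positive in coordinate [i.+1], where all points of [u] vanish, so the sign
     there can be reset. *)
  pose s' j := (j != inord i.+1) && s j.
  exists s' => p; rewrite inE => /orP[/eqP->|/us[[p0 p1] pi]].
    by split; [apply: e_orth; rewrite /s' eqxx | move=> j; exact: e_far].
  split=> [|j ij]; last by apply: pi; exact: ltnW.
  have ss' j : (-1) ^+ s' j * p 0 j = (-1) ^+ s j * p 0 j.
    rewrite /s'; case: eqP => // ->; rewrite [p _ _]pi ?mulr0 //.
    by rewrite inordK.
  by split=> [j|]; [rewrite ss' | under eq_bigr do rewrite ss'].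
rewrite /= => /mapP[u + ->]; rewrite mem_cat => /orP[ui|/mapP[u' ui ->]].
  by have [su [s us]] := IH u (ltnW iN) ui; apply: key us.
have [su [s us]] := IH u' (ltnW iN) ui; apply: (key _ (fun j => ~~ s j)).
  by rewrite size_map.
move=> _ /mapP[p /us[[p0 p1] pi] ->].
have e' j : (-1) ^+ (~~ s j) * (- p) 0 j = (-1) ^+ s j * p 0 j.
  by rewrite mxE; case: (s j); rewrite /= ?expr0 ?expr1 ?mulN1r ?mul1r ?opprK.
split=> [|j /pi pj]; last by rewrite mxE pj oppr0.
by split=> [j|]; [rewrite e' | under eq_bigr do rewrite e'].
Qed.

Lemma sdk_hemi_sphere k i v u : (i <= n)%N -> v \in hemi i -> u \in sdk k i.+1 v ->
  size u = i.+1 /\ {in u, forall p, cross_sphere p}.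
Proof.
move=> iN /(hemiP iN)[sv [s vs]] /(sdkP sv)[su uQ]; split=> // p pu.
apply: (@orthant_sphere s); by apply: (uQ _ (@bconvex_orthant s) _ p pu) => q /vs[].
Qed.

Lemma sum_sdk_hemi F k i : (i < n)%N ->
  \sum_(v <- hemi i.+1) \sum_(u <- sdk k i.+2 v) dl F u =
  \sum_(v <- hemi i) \sum_(u <- sdk k i.+1 v) (F u + F (map -%R u)).
Proof.
move=> iN; rewrite (eq_big_seq (dl (fun w => \sum_(u <- sdk k i.+1 w) F u))); last first.
  by move=> v /(hemiP iN)[sv _]; rewrite sdk_chain.
rewrite dl_hemi; apply: eq_bigr => v _.
by rewrite (sdk_map -%R) big_map -big_split.
Qed.

Definition odd_sign (x : E -> 'F_2) := forall p, cross_sphere p -> x (- p) = x p + 1.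

Lemma cup_opp xs l : (forall x, List.In x xs -> odd_sign x) ->
  {in l, forall p, cross_sphere p} -> cup xs (map -%R l) = cup xs l.
Proof.
elim: xs l => [|x xs IH] [|p [|q l]] //= xsodd lS.
have xo : odd_sign x by apply: xsodd; left.
rewrite (xo p) ?(xo q); [|by apply: lS; rewrite !inE eqxx ?orbT..].
rewrite (IH (q :: l)) => [|y yxs|r rl]; [|by apply: xsodd; right|by apply: lS; rewrite inE rl orbT].
by congr (_ * _); rewrite addrACA addF2 addr0.
Qed.

(** A Stokes argument: [cup (x :: xs)] is the coboundary of [xcup x xs], and the boundary of a
    hemisphere is the next smaller one plus its antipode. As [x] is odd and [cup xs] even, the two
    values of [xcup x xs] add up to [cup xs], which lowers the dimension down to a single point. *)
Lemma cup_hemi k xs : (size xs <= n)%N -> (forall x, List.In x xs -> odd_sign x) ->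
  \sum_(v <- hemi (size xs)) \sum_(u <- sdk k (size xs).+1 v) cup xs u = 1.
Proof.
elim: xs => [|x xs IH] xsn xsodd.
  rewrite [size _]/= big_seq1.
  rewrite (eq_big_seq (dl (fun=> 1))); last first.
    move=> u uk; have [] := @sdkP _ _ k 1 [:: e 0] u erefl uk.
    by case: u {uk} => [|p []] //= _ _; rewrite dl_cons /dl big_nil addr0.
  by rewrite sdk_chain // big_seq1 sdk_nil big_seq1.
rewrite -[RHS](IH (ltnW xsn)); last by move=> y yxs; apply: xsodd; right.
rewrite [size _]/= (eq_big_seq (fun v => \sum_(u <- sdk k (size xs).+2 v) dl (xcup x xs) u)); last first.
  move=> v vi; apply: eq_big_seq => u uv.
  by rewrite dl_xcup // (sdk_hemi_sphere xsn vi uv).1.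
rewrite sum_sdk_hemi //; apply: eq_big_seq => v vi; apply: eq_big_seq => u uv.
have [su uS] := sdk_hemi_sphere (ltnW xsn) vi uv.
case: u su uS {uv} => [//|p u] _ uS.
have -> : xcup x xs (map -%R (p :: u)) = x (- p) * cup xs (map -%R (p :: u)) by [].
rewrite cup_opp //; last by move=> y yxs; apply: xsodd; right.
have -> : x (- p) = x p + 1 by apply: xsodd; [left|apply: uS; rewrite inE eqxx].
by rewrite mulrDl mul1r addrA addF2 add0r.
Qed.

(* A sign of [p] that changes at [- p]; it only serves where [g i] vanishes. *)
Let sign p := p == choose [pred q | (q == p) || (q == - p)] p.

Let signN p : p != - p -> sign (- p) = ~~ sign p.
Proof.
move=> pNp; rewrite /sign.
have -> : choose [pred q | (q == - p) || (q == - - p)] (- p) =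
          choose [pred q | (q == p) || (q == - p)] p.
  rewrite (@choose_id _ _ (- p) p) /= ?opprK ?eqxx ?orbT //.
  by apply: eq_choose => q /=; rewrite orbC.
have := @chooseP _ [pred q | (q == p) || (q == - p)] p.
rewrite /= eqxx => /(_ isT) /orP[]/eqP->; rewrite eqxx ?[- p == p]eq_sym (negPf pNp) //.
Qed.

(* Signs of the coordinates of [g] give odd 0-cochains.  Their cup product is 1
   on the subdivided hemisphere, by [cup_hemi], but if [g] has no zero then some
   coordinate has constant sign on each small simplex, so it is 0. *)
Theorem borsuk_ulam (g : E -> 'rV[R]_n) : {within cross_sphere, continuous g} ->
  (forall p, cross_sphere p -> g (- p) = - g p) -> exists2 p, cross_sphere p & g p = 0.
Proof.
move=> gc godd; apply/not_exists2P => g0.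
pose P (ib : 'I_n * bool) p := 0 < (-1) ^+ ib.2 * g p 0 ib.1.
have [p Sp|d d0 dP] := @lebesgue_number _ _ cross_sphere _ P compact_cross_sphere _.
  have [i gi] : exists i, g p 0 i != 0.
    apply/existsP; apply: contraT => /existsPn gp.
    have [//|] := g0 p; case; apply/rowP => i; rewrite mxE; apply/eqP.
    by have := gp i; rewrite negbK.
  have bg : 0 < (-1) ^+ (g p 0 i < 0)%R * g p 0 i.
    case: (ltP (g p 0 i) 0) => gi0; first by rewrite mulN1r oppr_gt0.
    by rewrite mul1r lt_neqAle eq_sym gi.
  exists (i, g p 0 i < 0).
  have /subspace_continuousP/(_ p Sp) gp := gc.
  have gpi : (-1) ^+ (g p 0 i < 0)%R * g q 0 i @[q --> within cross_sphere (nbhs p)] -->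
      (-1) ^+ (g p 0 i < 0)%R * g p 0 i.
    apply: (@cvgMl_tmp _ _ (within cross_sphere (nbhs p))).
    apply: (@cvg_comp _ _ _ g (fun v : 'rV[R]_n => v 0 i) _ _ _ gp).
    exact: (@coord_continuous _ _ _ 0 i (g p)).
  have /nbhs_ballP[r /= r0 pr] : \forall q \near p, cross_sphere q -> P (i, g p 0 i < 0) q.
    have := cvgr_gt _ gpi _ bg; exact.
  exists r; split=> // q Sq pq; apply: pr => //.
  by rewrite -ball_normE.
pose x i p : 'F_2 := (if g p 0 i == 0 then sign p else 0 < g p 0 i)%:R.
pose xs := [seq x i | i <- enum 'I_n].
have sxs : size xs = n by rewrite size_map size_enum_ord.
have xsodd y : List.In y xs -> odd_sign y.
  move=> /List.in_map_iff[i [<- _]] p Sp.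
  have pNp : p != - p.
    rewrite -addr_eq0 -mulr2n -scaler_nat scaler_eq0 pnatr_eq0 /=.
    apply: contraPneq Sp => ->; rewrite /cross_sphere /= big1 ?(eq_sym 0) => [|j _]; last by rewrite mxE normr0.
    by move/esym/eqP; rewrite oner_eq0.
  rewrite /x godd // !mxE oppr_eq0 signN // oppr_gt0.
  have neg1 (b : bool) : (~~ b)%:R = b%:R + 1 :> 'F_2 by case: b; rewrite /= ?addF2 ?add0r.
  rewrite -neg1; case: (ltgtP (g p 0 i) 0) => //.
have [k kP] := @sdk_small R E n.+1 2 d (ler0n _ 2) d0.
have := cup_hemi k (_ : (size xs <= n)%N) xsodd; rewrite sxs leqnn => /(_ isT).
rewrite big1_seq ?(eq_sym 0) => [/esym/eqP|v vn]; first by rewrite oner_eq0.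
rewrite big1_seq // => u /andP[_ uv].
case/andP: vn => _ vn.
have [su uS] := sdk_hemi_sphere (leqnn n) vn uv.
have vS q : q \in v -> cross_sphere q.
  by have [_ [s vs]] := hemiP (leqnn n) vn; move=> /vs[/orthant_sphere].
have ud : {in u &, forall p q, `|p - q| < d}.
  apply: kP uv; first exact: (hemiP (leqnn n) vn).1.
  move=> p q /vS/cross_sphere_norm p1 /vS/cross_sphere_norm q1.
  by rewrite (le_trans (ler_normB _ _)) // -[2]/(1 + 1) lerD.
case: u su uS ud {uv} => [//|p u] su uS ud.
have pu : p \in p :: u by rewrite inE eqxx.
have [[i b] Pp] := dP p (uS p pu).
apply: (@cup_const _ _ _ i); rewrite ?sxs //.
have key q : List.In q (p :: u) -> x i q = (~~ b)%:R.
  move=> qu; have {}qu : q \in p :: u.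
    by elim: (p :: u) qu => //= r w IH [->|/IH]; rewrite inE ?eqxx // => ->; rewrite orbT.
  have := Pp q (uS q qu) (ud p q pu qu); rewrite /P /x /=.
  case: (b) => /=; rewrite ?mulN1r ?mul1r ?oppr_gt0; by case: ltgtP.
move=> q r qu ru; rewrite (nth_map i) ?size_enum_ord // nth_ord_enum.
by rewrite !key.
Qed.

End BorsukUlam.

(** * Complexes that are locally embedded in 3-space *)

Section Book.
Variables (R : realType) (V : finType).
Local Notation E := ('rV[R]_4).
Local Open Scope classical_set_scope.

Lemma cvg_ptws (T : Type) (F : set_system T) (FF : Filter F) (h : T -> {ptws V -> R}) (f : {ptws V -> R}) :
  (forall v, h x v @[x --> F] --> f v) -> h @ F --> f.
Proof.
move=> hf; apply/cvg_sup => v A /= [_ [[B Bop <-] Bf sBA]].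
have nB : nbhs (f v) B := open_nbhs_nbhs (conj Bop Bf).
apply: (@filterS _ F FF ((fun x => h x v) @^-1` B) (h @^-1` A)); last exact: hf nB.
by move=> x Bx; exact: sBA.
Qed.

(* Otherwise [f (H p) - f (H (- p))] is odd without zero. *)
Lemma no_odd_pair (A : set {ptws V -> R}) (f : {ptws V -> R} -> 'rV[R]_3) (H : E -> {ptws V -> R}) :
  {within A, continuous f} -> {in A &, injective f} -> continuous H ->
  (forall p, @cross_sphere R 3 p -> A (H p)) ->
  (forall p, @cross_sphere R 3 p -> H p <> H (- p)) -> False.
Proof.
move=> fc finj Hc HA Hp.
pose g p := f (H p) - f (H (- p)).
have SN p : @cross_sphere R 3 p -> @cross_sphere R 3 (- p).
  by rewrite /cross_sphere /= => <-; apply: eq_bigr => j _; rewrite mxE normrN.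
have [||p Sp gp] := @borsuk_ulam R 3 g.
- apply/subspace_continuousP => p Sp.
  have /subspace_continuousP fcA := fc.
  have key (h : E -> E) : continuous h -> (forall q, @cross_sphere R 3 q -> @cross_sphere R 3 (h q)) ->
      f (H (h q)) @[q --> within (@cross_sphere R 3) (nbhs p)] --> f (H (h p)).
    move=> hc hS.
    apply: (@cvg_comp _ _ _ (fun q => H (h q)) f _ (within A (nbhs (H (h p))))); last first.
      exact: (fcA (H (h p)) (HA _ (hS _ Sp))).
    move=> B nB; have : nbhs p [set q | A (H (h q)) -> B (H (h q))].
      exact: (continuous_comp (hc p) (Hc (h p)) nB).
    by apply: filterS => q qB Sq; apply: qB; exact/HA/hS.
  apply: cvgB.
    by apply: (key id) => // ?; exact: cvg_id.
  by apply: (key (fun q => - q)) => // ?; exact: opp_continuous.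
- by move=> p _; rewrite /g opprK opprB.
move/eqP: gp; rewrite /g subr_eq0 => /eqP /finj; rewrite !inE => /(_ (HA p Sp) (HA _ (SN p Sp))).
exact: Hp.
Qed.

Definition locally_in_space3 (X : set {ptws V -> R}) := forall x, X x ->
  exists (U : set {ptws V -> R}) (f : {ptws V -> R} -> 'rV[R]_3),
    [/\ open U, U x, {within X `&` U, continuous f} & {in X `&` U &, injective f}].

(** The sphere is shrunk until its image lies in one chart around [H 0]. *)
Lemma no_local_odd_pair (X : set {ptws V -> R}) (H : E -> {ptws V -> R}) :
  locally_in_space3 X -> continuous H ->
  (exists2 r : R, 0 < r & forall p : E, (forall j, `|p 0 j| <= r) -> X (H p)) ->
  (forall p, p != 0 -> H p <> H (- p)) -> False.
Proof.
move=> locX Hc [r r0 HX] Hinj.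
have [|U [f [Uop U0 fc finj]]] := locX (H 0).
  by apply: HX => j; rewrite mxE normr0 ltW.
have : nbhs (0 : E) (H @^-1` U) by apply: Hc; apply: open_nbhs_nbhs.
move=> /nbhs_ballP[d /= d0 dU].
(* The bound [r] keeps the image in [X], and [d / 2] keeps it in [U]. *)
pose c := Num.min r (d / 2).
have c0 : 0 < c by rewrite lt_min r0 divr_gt0.
have Sc p j : @cross_sphere R 3 p -> `|p 0 j| <= 1.
  by move=> <-; rewrite (bigD1 j) //= lerDl sumr_ge0.
apply: (@no_odd_pair (X `&` U) f (fun p => H (c *: p)) fc finj).
- by move=> p; apply: (continuous_comp (@scaler_continuous _ _ c p)); exact: Hc.
- move=> p Sp; split.
    apply: HX => j; rewrite mxE normrM gtr0_norm // (le_trans (ler_piMr (ltW c0) (Sc p j Sp))) //.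
    by rewrite ge_min lexx.
  apply: dU; rewrite -ball_normE /= sub0r normrN normrZ gtr0_norm //.
  rewrite (le_lt_trans (ler_piMr (ltW c0) (cross_sphere_norm Sp))) //.
  by rewrite gt_min ltr_pdivrMr // ltr_pMr // ltr1n orbT.
move=> p Sp; rewrite scalerN; apply: Hinj.
rewrite scaler_eq0 gt_eqF //=; apply: contraPneq Sp => ->.
rewrite /cross_sphere /= big1 => [|j _]; last by rewrite mxE normr0.
by move/esym/eqP; rewrite oner_eq0.
Qed.

End Book.

(** * The two forbidden configurations: a 4-simplex, three tetrahedra on a triangle *)

Section Links.
Import boot.fintype boot.finset.

Lemma exists_injection (T : finType) (A : {set T}) n : (n <= #|A|)%N ->
  exists2 u : 'I_n -> T, injective u & forall i, u i \in A.
Proof.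
move=> nA; exists (fun i => enum_val (widen_ord nA i)) => [i j|i]; last exact: enum_valP.
by move/enum_val_inj/(congr1 val) => ij; apply/val_inj.
Qed.

Variables (R : realType) (V : finType).
Local Notation E := ('rV[R]_4).

Lemma cvgc (c : R) (p : E) : (c @[_ --> p] --> c)%classic.
Proof. exact: (@cvg_cst _ _ _ _ (nbhs_filter p)). Qed.

Lemma continuous_ptws (H : E -> {ptws V -> R}) :
  (forall v, continuous (fun p => H p v)) -> continuous H.
Proof. by move=> Hc p; apply: (@cvg_ptws _ _ _ (nbhs p) (nbhs_filter p)) => v; exact: Hc. Qed.

Lemma sum_eq1 (u : V) : \sum_v (v == u)%:R = 1 :> R.
Proof. by rewrite (bigD1 u) //= eqxx big1 ?addr0 // => v /negPf->. Qed.

(* [a + b + c = 0] parametrizes the plane, and [pages a b c] maps it to a tripod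
   such that antipodal points other than the origin have distinct images.  Hence
   [R^2] times a tripod carries an odd pair in the sense of [no_odd_pair]. *)
Definition page (a b c : R) : R := Num.max 0 (a - Num.max b c).

Lemma page_le a b c r : `|a| <= r -> `|b| <= r -> `|c| <= r -> 0 <= page a b c <= 2 * r.
Proof.
rewrite !ler_norml => /andP[? ?] /andP[? ?] /andP[? ?].
by rewrite /page; case: (leP b c) => ?; [case: (leP 0 (a - c))|case: (leP 0 (a - b))] => ?; apply/andP; split; lra.
Qed.

Lemma page_neq0 a b c : page a b c != 0 -> b < a /\ c < a.
Proof.
rewrite /page; case: (leP b c) => ?; [case: (ltP 0 (a - c))|case: (ltP 0 (a - b))]; rewrite ?eqxx // => ? _; by split; lra.
Qed.

Lemma page_eq0 a b c : page a b c = 0 -> a <= b \/ a <= c.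
Proof.
by rewrite /page; case: (leP b c) => ?; [case: (leP 0 (a - c)) => ? ?; right|case: (leP 0 (a - b)) => ? ?; left]; lra.
Qed.

Definition pages (a b c : R) (i : 'I_3) : R :=
  nth 0 [:: page a b c; page b c a; page c a b] i.

Lemma ord3P (P : 'I_3 -> Prop) : P ord0 -> P (inord 1) -> P ord_max -> forall i, P i.
Proof.
move=> P0 P1 P2 [[|[|[|//]]] i].
- by rewrite (_ : Ordinal i = ord0) //; apply/val_inj.
- by rewrite (_ : Ordinal i = inord 1) //; apply/val_inj; rewrite /= inordK.
- by rewrite (_ : Ordinal i = ord_max) //; apply/val_inj.
Qed.

(** A page is nonzero exactly when its first argument is the strict maximum of the three. *)
Lemma pages_disjoint a b c i j : pages a b c i != 0 -> pages a b c j != 0 -> i = j.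
Proof.
move: i j; do 2 apply: ord3P; rewrite /pages /= ?inordK //= => /page_neq0[? ?] /page_neq0[? ?] //; exfalso; lra.
Qed.

(** A strict maximum of (a, b, c) cannot also be one of the negatives, so all pages vanish on both
    sides. With neither a strict maximum nor a strict minimum, the three numbers are equal, hence 0
    as they sum to 0. *)
Lemma pages_opp a b c : a + b + c = 0 ->
  (forall i, pages a b c i = pages (- a) (- b) (- c) i) -> a = 0 /\ b = 0.
Proof.
move=> abc e.
have z i : pages a b c i = 0.
  apply/eqP; apply: contraT => n1; have := n1; rewrite e; move: n1.
  by move: i; apply: ord3P; rewrite /pages /= ?inordK //= => /page_neq0[? ?] /page_neq0[? ?] //; exfalso; lra.
have z' i : pages (- a) (- b) (- c) i = 0 by rewrite -e z.
move: (z ord0) (z (inord 1)) (z ord_max) (z' ord0) (z' (inord 1)) (z' ord_max).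
rewrite /pages /= ?inordK //=.
do 6 move=> /page_eq0 ?.
have -> : a = 0 by lra.
split=> //; lra.
Qed.

Lemma underlying_spaceP (C : {set {set V}}) (w : {ptws V -> R}) (t : {set V}) :
  t \in C -> (forall v, v \in t -> 0 < w v) -> (forall v, v \notin t -> w v = 0) ->
  \sum_v w v = 1 -> underlying_space C w.
Proof.
move=> tC wt wt' w1; split=> // [v|].
  by case: (boolP (v \in t)) => [/wt/ltW//|/wt'->].
rewrite (_ : [set v | w v != 0] = t) //; apply/setP => v; rewrite inE.
by case: (boolP (v \in t)) => [/wt/gt_eqF->|/wt'->]; rewrite ?eqxx.
Qed.

Variable C : {set {set V}}.
Hypotheses (CC : simplicial_complex C) (locC : locally_in_space3 (@underlying_space R V C)).

Lemma card_faces_le4 : {in C, forall s : {set V}, (#|s| <= 4)%N}.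
Proof.
move=> s sC; rewrite leqNgt; apply/negP => s5.
have [u uinj us] := exists_injection s5.
pose t := [set u i | i : 'I_5].
have ct : #|t| = 5 by rewrite card_imset // card_ord.
have tC : t \in C.
  apply: CC.2 sC _ _; last by rewrite -card_gt0 ct.
  by apply/subsetP => _ /imsetP[i _ ->].
(* Starting at the barycenter of [t], [H p] moves the mass [p 0 j] from the last vertex to vertex
   [j]; this is injective in [p]. *)
pose a v j : R := (v == u (lift ord_max j))%:R - (v == u ord_max)%:R.
pose H (p : E) : {ptws V -> R} := fun v => (v \in t)%:R / 5 + \sum_j p 0 j * a v j.
have a1 v j : `|a v j| <= 1.
  rewrite /a ler_norml; case: (v == _); case: (v == _) => /=; apply/andP; split; lra.
apply: (no_local_odd_pair (H := H) locC).
- apply: continuous_ptws => v p.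
  change ((fun q : E => (v \in t)%:R / 5 + \sum_j q 0 j * a v j) @ p -->
    ((v \in t)%:R / 5 + \sum_j p 0 j * a v j : R))%classic.
  apply: (@cvgD _ _ _ (nbhs p) (nbhs_filter p)); first exact: cvgc.
  apply: (@cvg_bigsum _ _ (nbhs p) (nbhs_filter p)) => j.
  by apply: (@cvgM _ _ (nbhs p) (nbhs_filter p)); [exact: coord_continuous | exact: cvgc].
(* A barycentric coordinate moves by at most 4/25, less than its initial 1/5. *)
- exists (1 / 25) => [|p pr]; first by lra.
  apply: (underlying_spaceP tC) => [v vt|v vt|].
  + have : `|\sum_j p 0 j * a v j| <= 4 * (1 / 25).
      apply: le_trans (ler_norm_sum _ _ _) _.
      apply: le_trans (ler_sum _ (_ : forall j, true -> _ <= 1 / 25)) _.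
        by move=> j _; rewrite normrM -[leRHS]mulr1 ler_pM.
      by rewrite big_const_ord iter_addr_0 mulr_natl.
    by rewrite ler_norml /H vt => /andP[? _] /=; lra.
  + rewrite /H (negPf vt) mul0r add0r big1 // => j _.
    have nu i : (v == u i) = false.
      by apply: contraNF vt => /eqP->; apply/imsetP; exists i.
    by rewrite /a !nu subrr mulr0.
  rewrite /H big_split /= exchange_big /= [X in _ + X]big1 ?addr0 => [|j _].
    rewrite -mulr_suml -natr_sum -big_mkcond /= sum1_card ct; lra.
  by rewrite -mulr_sumr /a sumrB !sum_eq1 subrr mulr0.
move=> p p0 Hp; case/eqP: p0; apply/rowP => j; rewrite mxE.
have /(congr1 (fun w : {ptws V -> R} => w (u (lift ord_max j)))) := Hp.
have aE i : a (u (lift ord_max j)) i = (i == j)%:R.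
  rewrite /a !(inj_eq uinj) (inj_eq (@lift_inj _ _)) [lift _ _ == ord_max]eq_sym.
  by rewrite (negPf (neq_lift _ _)) subr0 eq_sym.
have sumE (q : E) : \sum_i q 0 i * a (u (lift ord_max j)) i = q 0 j.
  rewrite (bigD1 j) //= aE eqxx mulr1 big1 ?addr0 // => i /negPf ij.
  by rewrite aE ij mulr0.
by rewrite /H !sumE mxE; lra.
Qed.

Lemma tetrahedra_le2 : {in faces C 3, forall s : {set V},
  (#|[set t in faces C 4 | s \subset t]| <= 2)%N}.
Proof.
move=> s; rewrite mem_faces => /andP[sC /eqP cs]; rewrite leqNgt; apply/negP => t3.
have [t tinj tS] := exists_injection t3.
have [u uinj us] : exists2 u : 'I_3 -> V, injective u & forall i, u i \in s.
  by apply: exists_injection; rewrite cs.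
have xP i : exists x, x \notin s /\ x |: s = t i.
  have := tS i; rewrite inE mem_faces => /andP[/andP[_ /eqP ct] st].
  have [x xt xs] : exists2 x, x \in t i & x \notin s.
    by apply/subsetPn; apply: contraTN isT => ts; have := subset_leq_card ts; rewrite cs ct.
  exists x; split=> //; apply/eqP.
  by rewrite eqEcard subUset sub1set xt st cardsU1 xs cs ct.
have {xP} /choice[x xP] := xP.
have xs i : x i \notin s by case: (xP i).
have xinj : injective x by move=> i j xij; apply: tinj; rewrite -!(xP _).2 xij.
have xC i : x i |: s \in C.
  by rewrite (xP i).2; have := tS i; rewrite inE mem_faces => /andP[/andP[]].
pose P (p : E) := pages (p 0 (inord 2)) (p 0 (inord 3)) (- p 0 (inord 2) - p 0 (inord 3)).
pose a v (j : 'I_3) : R := (v == u j)%:R - (v == u ord_max)%:R.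
pose b v (i : 'I_3) : R := (v == x i)%:R - (v \in s)%:R / 3.
(* Coordinates 0 and 1 move within the triangle [s]; coordinates 2 and 3 become, through the pages,
   the weight of at most one of the three apexes [x i], taken evenly from [s]. *)
pose H (p : E) : {ptws V -> R} := fun v => (v \in s)%:R / 3 +
  (p 0 (inord 0) * a v ord0 + p 0 (inord 1) * a v (inord 1)) + \sum_i P p i * b v i.
have sum_a j : \sum_v a v j = 0 by rewrite /a sumrB !sum_eq1 subrr.
have sum_s : \sum_v (v \in s)%:R / 3 = 1 :> R.
  rewrite -mulr_suml -natr_sum -big_mkcond /= sum1_card cs; lra.
have sum_b i : \sum_v b v i = 0 by rewrite /b sumrB sum_eq1 sum_s subrr.
have a_out v j : v \notin s -> a v j = 0.
  move=> vs; rewrite /a; have nu i : (v == u i) = false.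
    by apply: contraNF vs => /eqP->.
  by rewrite !nu subrr.
have b_x i j : b (x i) j = (i == j)%:R.
  by rewrite /b (negPf (xs i)) mul0r subr0 (inj_eq xinj).
apply: (no_local_odd_pair (H := H) locC).
- apply: continuous_ptws => v p.
  have cc (j : 'I_4) : {for p, continuous (fun p : E => p 0 j : R^o)} by exact: coord_continuous.
  have cpage (f g h : E -> R^o) : {for p, continuous f} -> {for p, continuous g} ->
     {for p, continuous h} -> {for p, continuous (fun q => page (f q) (g q) (h q) : R^o)}.
    move=> cf cg ch; apply: (continuous_max (f := fun=> 0)); first exact: cvgc.
    by apply: (@cvgB _ _ _ (nbhs p) (nbhs_filter p)) => //; exact: continuous_max.
  have cw : {for p, continuous (fun p : E => - p 0 (inord 2) - p 0 (inord 3) : R^o)}.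
    by apply: (@cvgB _ _ _ (nbhs p) (nbhs_filter p)); [apply: (@cvgN _ _ _ (nbhs p) (nbhs_filter p))|]; exact: cc.
  change ((fun q : E => (v \in s)%:R / 3 +
      (q 0 (inord 0) * a v ord0 + q 0 (inord 1) * a v (inord 1)) + \sum_i P q i * b v i) @ p -->
    ((v \in s)%:R / 3 + (p 0 (inord 0) * a v ord0 + p 0 (inord 1) * a v (inord 1)) +
      \sum_i P p i * b v i : R))%classic.
  apply: (@cvgD _ _ _ (nbhs p) (nbhs_filter p)).
    apply: (@cvgD _ _ _ (nbhs p) (nbhs_filter p)); first exact: cvgc.
    by apply: (@cvgD _ _ _ (nbhs p) (nbhs_filter p)); apply: (@cvgM _ _ (nbhs p) (nbhs_filter p)); solve [exact: cc | exact: cvgc].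
  apply: (@cvg_bigsum _ _ (nbhs p) (nbhs_filter p)) => i.
  apply: (@cvgM _ _ (nbhs p) (nbhs_filter p)); last exact: cvgc.
  by move: i; apply: ord3P; rewrite /P /pages /= ?inordK //=; apply: cpage.
(* A vertex of [s] loses at most 1/30 within the triangle. Each page is at most 1/15 and takes a
   third of its weight from each vertex, so three pages take at most 1/15; the total stays below
   1/3. *)
- exists (1 / 60) => [|p pr]; first by lra.
  have Pb i : 0 <= P p i <= 1 / 15.
    have w2 : `|- p 0 (inord 2) - p 0 (inord 3)| <= 1 / 30.
      by move: (pr (inord 2)) (pr (inord 3)); rewrite !ler_norml => /andP[? ?] /andP[? ?]; apply/andP; split; lra.
    have pr' j : `|p 0 j| <= 1 / 30 by apply: le_trans (pr j) _; lra.
    rewrite (_ : 1 / 15 = 2 * (1 / 30)); last by lra.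
    by move: i; apply: ord3P; rewrite /P /pages /= ?inordK //=; apply: page_le.
  have Hs v : v \in s -> 0 < H p v.
    move=> vs; rewrite /H vs.
    have vx i : (v == x i) = false by apply: contraTF vs => /eqP->.
    have : \sum_i P p i * b v i >= \sum_(i < 3) (- (1 / 45)).
      apply: ler_sum => i _; rewrite /b vx vs /=; have /andP[? ?] := Pb i; lra.
    rewrite big_const_ord iter_addr_0 => sP.
    have := pr (inord 0); have := pr (inord 1); rewrite !ler_norml.
    rewrite /a => /andP[? ?] /andP[? ?]; rewrite -mulr_natl in sP.
    by case: (v == u ord0); case: (v == u (inord 1)); case: (v == u ord_max); rewrite /=; lra.
  have Hx i : H p (x i) = P p i.
    rewrite /H !a_out // (negPf (xs i)) mul0r !mulr0 !add0r (bigD1 i) //= b_x eqxx mulr1.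
    by rewrite big1 ?addr0 // => j ji; rewrite b_x eq_sym (negPf ji) mulr0.
  have Hout v : v \notin s -> (forall i, v = x i -> P p i = 0) -> H p v = 0.
    move=> vs vx; rewrite /H !a_out // (negPf vs) mul0r !mulr0 !add0r big1 // => i _.
    by rewrite /b (negPf vs) mul0r subr0; case: eqP => [/vx->|]; rewrite ?mul0r ?mulr0.
  have H1 : \sum_v H p v = 1.
    rewrite /H !big_split /= sum_s -!mulr_sumr !sum_a !mulr0 exchange_big /= big1 ?addr0 // => i _.
    by rewrite -mulr_sumr sum_b mulr0.
  have [/existsP[i Pi]|/existsPn noP] := boolP [exists i, P p i != 0].
    apply: (underlying_spaceP (xC i)) => // [v|v].
      rewrite inE => /orP[|/Hs//]; rewrite inE => /eqP->; rewrite Hx lt_neqAle eq_sym Pi.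
      by have /andP[] := Pb i.
    rewrite !inE negb_or => /andP[vx vs]; apply: Hout => // j vxj; apply/eqP.
    by apply: contraNT vx => Pj; rewrite vxj (pages_disjoint Pi Pj).
  apply: (underlying_spaceP sC) => // v vs; apply: Hout => // i _.
  by apply/eqP; have := noP i; rewrite negbK.
move=> p p0 Hp; case/eqP: p0.
have HE v : H p v = H (- p) v by rewrite Hp.
have PE i : P p i = P (- p) i.
  have Hx q : H q (x i) = P q i.
    rewrite /H !a_out // (negPf (xs i)) mul0r !mulr0 !add0r (bigD1 i) //= b_x eqxx mulr1.
    by rewrite big1 ?addr0 // => j ji; rewrite b_x eq_sym (negPf ji) mulr0.
  by rewrite -!Hx HE.
have [p2 p3] : p 0 (inord 2) = 0 /\ p 0 (inord 3) = 0.
  apply: (@pages_opp _ _ (- p 0 (inord 2) - p 0 (inord 3))); first by lra.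
  by move=> i; have := PE i; rewrite /P !mxE => ->; congr (pages _ _ _ i); ring.
have Hu j : j != ord_max -> p 0 (inord 0) * a (u j) ord0 + p 0 (inord 1) * a (u j) (inord 1) = 0.
  move=> _; have := HE (u j); rewrite /H; under [X in _ = _ + X]eq_bigr do rewrite -PE.
  by rewrite !mxE; lra.
have := Hu ord0 isT; have := Hu (inord 1); rewrite /a !(inj_eq uinj) -!val_eqE /= inordK //= ?eqxx.
move=> /(_ isT) p1 p0'.
apply/rowP => -[[|[|[|[|//]]]] i]; rewrite mxE.
- by rewrite (_ : Ordinal i = inord 0); [lra | apply/val_inj; rewrite /= inordK].
- by rewrite (_ : Ordinal i = inord 1); [lra | apply/val_inj; rewrite /= inordK].
- by rewrite (_ : Ordinal i = inord 2); [|apply/val_inj; rewrite /= inordK].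
- by rewrite (_ : Ordinal i = inord 3); [|apply/val_inj; rewrite /= inordK].
Qed.

Lemma locally_in_space3_surface_links : surface_links C.
Proof. by split; [exact: card_faces_le4 | exact: tetrahedra_le2]. Qed.

End Links.

(** * Generic directions *)

Section BoxCover.
Variable R : realType.
Local Open Scope classical_set_scope.
Local Open Scope ereal_scope.

(* By induction on [k], integrating the bound for the slices of the boxes. *)
Lemma box_cover_volume k (c d : 'I_k -> R) (D : pred nat) (a b : nat -> 'I_k -> R) :
  (forall j, c j <= d j)%R -> (forall i j, a i j <= b i j)%R ->
  (forall x : 'I_k -> R, (forall j, c j <= x j <= d j)%R ->
     exists2 i, D i & forall j, (a i j <= x j <= b i j)%R) ->
  (\prod_j (d j - c j))%:E <= \sum_(i <oo | D i) (\prod_j (b i j - a i j))%:E.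
Proof.
elim: k c d D a b => [|k IH] c d D a b cd ab cover.
  (* In dimension 0 the empty products are 1, so one box that covers the only point suffices. *)
  have [i Di _] := cover c (fun j => ltac:(by case: j)).
  rewrite big_ord0 eseries_mkcond.
  apply: le_trans (nneseries_lim_ge i.+1 _) => [|n _]; last by case: ifP; rewrite // big_ord0.
  rewrite big_mkord big_ord_recr /= Di big_ord0 leeDr //.
  by apply: sume_ge0 => j _; case: ifP; rewrite // big_ord0.
pose w i : R := if D i then (\prod_(j < k) (b i (lift ord0 j) - a i (lift ord0 j)))%R else 0%R.
have w0 i : (0 <= w i)%R by rewrite /w; case: ifP => // _; apply: prodr_ge0 => j _; rewrite subr_ge0.
pose B i := `[a i ord0, b i ord0].
have len (x y : R) : (x <= y)%R -> lebesgue_measure `[x, y] = (y - x)%:E.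
  move=> xy; rewrite lebesgue_measure_itv /= lte_fin; case: (ltP x y) => // yx.
  by apply/esym/eqP; rewrite eqe subr_eq0 eq_le yx xy.
pose I := `[c ord0, d ord0].
have mI : measurable I := measurable_itv _.
have mB i : measurable (B i) := measurable_itv _.
pose Q := (\prod_(j < k) (d (lift ord0 j) - c (lift ord0 j)))%R.
have Q0 : (0 <= Q)%R by apply: prodr_ge0 => j _; rewrite subr_ge0.
(* The volume of the slice of box [i] at height [t] in the first coordinate, zero for boxes outside
   [D]. *)
pose g i (t : measurableTypeR R) : \bar R := (w i)%:E * (\1_(B i) t)%:E.
have mg i : measurable_fun I (g i).
  apply: measurable_funeM; apply/measurable_EFinP; exact: (measurable_indic (mB i)).
have g0 i t : 0 <= g i t by rewrite mule_ge0 // lee_fin.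
have slice t : I t -> Q%:E <= \sum_(0 <= i <oo) g i t.
  rewrite /I /= in_itv /= => tI.
  pose Dt i := D i && (a i ord0 <= t <= b i ord0)%R.
  apply: le_trans (IH _ _ Dt (fun i j => a i (lift ord0 j)) (fun i j => b i (lift ord0 j)) _ _ _) _ => //.
    move=> x xQ.
    have [|i Di xi] := cover (fun j => if unlift ord0 j is Some j' then x j' else t).
      by move=> j; case: unliftP => [j' ->|->].
    exists i => [|j]; last by have := xi (lift ord0 j); rewrite liftK.
    by rewrite /Dt Di; have := xi ord0; rewrite unlift_none.
  rewrite eseries_mkcond; apply: lee_nneseries => i _.
    by move=> _; case: ifP => // _; rewrite lee_fin; apply: prodr_ge0 => j _; rewrite subr_ge0.
  rewrite /Dt; case: ifP => [/andP[Di tB]|_]; last exact: g0.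
  by rewrite /g /w Di indicE mem_set ?mule1 //= /B /= in_itv.
rewrite big_ord_recl mulrC -/Q eseries_mkcond.
have -> : (Q * (d ord0 - c ord0))%:E = \int[lebesgue_measure]_(t in I) cst Q%:E t.
  by rewrite integral_cst // EFinM -len.
apply: (@le_trans _ _ (\int[lebesgue_measure]_(t in I) \sum_(0 <= i <oo) g i t)).
  apply: ge0_le_integral => //.
  by have := @ge0_emeasurable_sum _ _ R I g predT (fun i t _ _ => g0 i t) (fun i _ => mg i).
rewrite integral_nneseries //; apply: lee_nneseries => i _.
  by move=> _; apply: integral_ge0.
have -> : \int[lebesgue_measure]_(t in I) g i t =
    (w i)%:E * \int[lebesgue_measure]_(t in I) (\1_(B i) t)%:E.
  apply: ge0_integralZl; rewrite ?lee_fin //.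
    by apply/measurable_EFinP; exact: (measurable_indic (mB i)).
have -> : \int[lebesgue_measure]_(t in I) (\1_(B i) t)%:E = lebesgue_measure (B i `&` I).
  exact: (integral_indic lebesgue_measure mI (mB i)).
apply: (@le_trans _ _ ((w i)%:E * lebesgue_measure (B i))).
  apply: lee_wpmul2l; first by rewrite lee_fin.
  by apply: le_measure; rewrite ?inE; [apply: measurableI; [exact: mB|exact: mI]|exact: mB|exact: subIsetl].
rewrite len // /w; case: ifP => Di; last by rewrite mul0e.
by rewrite big_ord_recl mulrC EFinM.
Qed.
End BoxCover.

(** * Directions outside a null set and finitely many hyperplanes *)

Section Generic.
Variables (R : realType) (k : nat).
Implicit Types (x y d : 'rV[R]_k).

Lemma dotDr x y d : dot d (x + y) = dot d x + dot d y.
Proof. by rewrite /dot -big_split; apply: eq_bigr => j _; rewrite mxE mulrDr. Qed.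

Lemma dotDl x y d : dot (x + y) d = dot x d + dot y d.
Proof. by rewrite /dot -big_split; apply: eq_bigr => j _; rewrite mxE mulrDl. Qed.

Lemma dotZl (a : R) x d : dot (a *: x) d = a * dot x d.
Proof. by rewrite /dot mulr_sumr; apply: eq_bigr => j _; rewrite mxE mulrA. Qed.

Lemma dot_delta d j (a : R) : dot d (a *: delta_mx 0 j) = a * d 0 j.
Proof.
rewrite /dot (bigD1 j) //= !mxE !eqxx mulr1 mulrC big1 ?addr0 // => i ij.
by rewrite !mxE (negPf ij) andbF !mulr0.
Qed.

Lemma generic_cube (ds : seq 'rV[R]_k) : {in ds, forall d, d != 0} ->
  exists (c : 'rV[R]_k) (r : R), 0 < r /\ forall x, (forall j, `|x 0 j - c 0 j| <= r) ->
    {in ds, forall d, dot d x != 0}.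
Proof.
elim: ds => [|d ds IH] ds0; first by exists 0, 1; split.
have [|c [r [r0 cr]]] := IH; first by move=> d' d'ds; apply: ds0; rewrite inE d'ds orbT.
have d0 : d != 0 by apply: ds0; rewrite inE eqxx.
have [c' c'c dc'] : exists2 c' : 'rV[R]_k, (forall j, `|c' 0 j - c 0 j| <= r / 2) & dot d c' != 0.
  have [dc|dc] := eqVneq (dot d c) 0; last first.
    by exists c => // j; rewrite subrr normr0 divr_ge0 // ltW.
  have [j dj] : exists j, d 0 j != 0.
    apply/existsP; apply: contraNT d0 => /existsPn dj; apply/eqP/rowP => j.
    by rewrite mxE; apply/eqP; have := dj j; rewrite negbK.
  exists (c + (r / 2) *: delta_mx 0 j) => [i|].
    rewrite !mxE addrAC subrr add0r normrM ger0_norm ?divr_ge0 ?(ltW r0) //.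
    by rewrite ler_piMr ?divr_ge0 ?(ltW r0) //=; case: (_ == j); rewrite ?normr1 ?normr0 //.
  by rewrite dotDr dc add0r dot_delta mulf_neq0 // gt_eqF // divr_gt0.
pose s := \sum_j `|d 0 j|.
have s0 : 0 <= s by apply: sumr_ge0.
(* With [r / 2] the new cube stays in the old one; the other bound makes [dot d] vary by less than
   its absolute value at [c']. *)
pose q := Num.min (r / 2) (`|dot d c'| / (2 * (s + 1))).
have q0 : 0 < q by rewrite lt_min !divr_gt0 ?normr_gt0 // mulr_gt0 // ltr_wpDl.
exists c', q; split=> // x xc d'; rewrite inE => /orP[/eqP->|d'ds]; last first.
  apply: (cr x) d'ds => j; rewrite -(subrKA (c' 0 j)) (splitr r).
  apply: le_trans (ler_normD _ _) _; apply: lerD => //.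
  by apply: le_trans (xc j) _; rewrite ge_min lexx.
have xE : x = c' + (x - c') by rewrite addrC subrK.
have lt_dot : `|dot d (x - c')| < `|dot d c'|.
  apply: (@le_lt_trans _ _ (s * q)).
    rewrite /dot /s mulr_suml; apply: le_trans (ler_norm_sum _ _ _) _.
    by apply: ler_sum => j _; rewrite normrM ler_wpM2l // !mxE.
  apply: (@le_lt_trans _ _ (s * (`|dot d c'| / (2 * (s + 1))))).
    by rewrite ler_wpM2l // /q ge_min lexx orbT.
  rewrite mulrA ltr_pdivrMr; last by rewrite mulr_gt0 // ltr_wpDl.
  rewrite mulrC ltr_pM2l ?normr_gt0 //; lra.
apply: contraTneq lt_dot => dx; rewrite -leNgt.
move: dx; rewrite {1}xE dotDr => /eqP; rewrite addr_eq0 => /eqP->.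
by rewrite normrN.
Qed.

(** Otherwise [N] contains a cube that avoids the hyperplanes, and boxes of half its volume would
    cover it, against [box_cover_volume]. *)
Lemma generic_direction (N : set 'rV[R]_k) (ds : seq 'rV[R]_k) : measure_zero N ->
  {in ds, forall d, d != 0} ->
  exists x, ~ N x /\ {in ds, forall d, dot d x != 0}.
Proof.
move=> N0 /generic_cube[c [r [r0 cr]]].
apply: contrapT => noN.
have cubeN x : (forall j, `|x 0 j - c 0 j| <= r) -> N x.
  by move=> xc; apply: contrapT => Nx; apply: noN; exists x; split=> //; exact: cr.
pose vol : R := \prod_(j < k) (2 * r).
have vol0 : 0 < vol by apply: prodr_gt0 => j _; rewrite mulr_gt0.
have [D [a [b [ab NU le_vol]]]] := N0 (vol / 2) (divr_gt0 vol0 (ltr0n _ 2)).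
have := @box_cover_volume R k (fun j => c 0 j - r) (fun j => c 0 j + r) D
  (fun i j => a i 0 j) (fun i j => b i 0 j) _ ab _.
rewrite (_ : \prod_j _ = vol); last by apply: eq_bigr => j _; lra.
move=> le_cover; have : (vol%:E <= (vol / 2)%:E)%E.
  apply: le_trans le_vol; apply: le_cover => [j|x xc]; first by lra.
  have /cubeN/NU[i /= Di xi] : forall j, `|(\row_j x j : 'rV_k) 0 j - c 0 j| <= r.
    by move=> j; rewrite mxE ler_distl.
  by exists i => // j; have := xi j; rewrite mxE.
by rewrite lee_fin; lra.
Qed.

End Generic.

(** * From simplicial to singular chains and back *)

(** Only parities of multiplicities count mod 2. This carries an equation between singular chains
    over to the approximations of their simplices. *)
Lemma parity_sum (T : eqType) (L L' : seq T) (F : T -> 'F_2) :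
  (forall y, \sum_(x <- L) (x == y)%:R = \sum_(x <- L') (x == y)%:R :> 'F_2) ->
  \sum_(x <- L) F x = \sum_(x <- L') F x.
Proof.
move=> LL'; pose U := undup (L ++ L').
have expand (M : seq T) : {subset M <= U} ->
    \sum_(x <- M) F x = \sum_(y <- U) (\sum_(x <- M) (x == y)%:R) * F y.
  move=> MU; under [RHS]eq_bigr do rewrite mulr_suml.
  rewrite exchange_big /=; apply: eq_big_seq => x /MU xU.
  rewrite (bigD1_seq x) ?undup_uniq //= eqxx mul1r big1 ?addr0 // => y.
  by rewrite eq_sym => /negPf->; rewrite mul0r.
rewrite !expand => [|x xL|x xL]; first by apply: eq_bigr => y _; rewrite LL'.
  by rewrite mem_undup mem_cat xL orbT.
by rewrite mem_undup mem_cat xL.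
Qed.

Section SingularLists.
Variables (R : realType) (T : topologicalType).
Local Open Scope classical_set_scope.

Definition chain_of_list n (L : seq (@std_simplex R n -> T)) : prechain R T n :=
  fun t => \sum_(x <- L) (x == t)%:R.

Lemma chain_of_list_supp n (L : seq (@std_simplex R n -> T)) t :
  chain_of_list L t != 0 -> t \in L.
Proof.
apply: contraNT => tL; rewrite /chain_of_list big_seq big1 // => x xL.
by case: eqP => // xt; rewrite -xt xL in tL.
Qed.

Lemma singular_chain_of_list (A : set T) n (L : seq (@std_simplex R n -> T)) :
  (forall s, s \in L -> singular_simplex A s) -> singular_chain A (chain_of_list L).
Proof.
move=> LA; split; last by move=> s /= /chain_of_list_supp /LA.
apply: (@sub_finite_set _ _ [set` L]); last exact: finite_seq.
by move=> s /= /chain_of_list_supp.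
Qed.

Lemma finite_chain_list n (c : prechain R T n) : finite_set [set s | c s != 0] ->
  exists2 L, c = chain_of_list L & forall s, s \in L -> c s != 0.
Proof.
move=> cfin; pose L := finmap.enum_fset (fset_set [set s | c s != 0]).
have LP s : (s \in L) = (c s != 0).
  by rewrite /L in_fset_set //; apply/idP/idP => [/set_mem|/mem_set].
exists L => [|s]; last by rewrite LP.
apply/funext => s; rewrite /chain_of_list; case: (boolP (s \in L)) => sL.
  rewrite (bigD1_seq s) ?finmap.fset_uniq //= eqxx big1 ?addr0 => [|x /negPf->//].
  by move: sL; rewrite LP => /F2_neq0.
rewrite big_seq big1 => [|x xL]; first by move: sL; rewrite LP negbK => /eqP.
by case: eqP => // xs; rewrite -xs xL in sL.
Qed.

Lemma singular_bd_list n (L : seq (@std_simplex R n.+1 -> T)) :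
  singular_bd (chain_of_list L) = chain_of_list [seq s \o coface i | s <- L, i <- enum 'I_n.+2].
Proof.
apply/funext => t; rewrite /singular_bd.
(* The sum in [singular_bd] ranges over a possibly infinite set, but only pairs with [s] in [L]
   contribute, each counted once whatever its multiplicity in [L]. *)
pose P := [seq (s, i) | s <- undup L, i <- enum 'I_n.+2].
have uP : uniq P by rewrite allpairs_uniq ?undup_uniq ?enum_uniq // => -[? ?] [? ?] _ _ [-> ->].
pose B := [set u : (@std_simplex R n.+1 -> T) * 'I_n.+2 | u.1 \o coface u.2 = t].
pose pB u := u.1 \o coface u.2 == t :> (@std_simplex R n -> T).
rewrite -(@fsbig_widen _ _ _ _ [set` [seq u <- P | pB u]] B (fun u => chain_of_list L u.1)); last 2 first.
- by move=> u /=; rewrite mem_filter => /andP[/eqP].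
- move=> [s i] /= [Bu nPu]; apply/eqP; apply: contraT => /chain_of_list_supp sL.
  exfalso; apply: nPu; rewrite /= mem_filter; apply/andP; split; first exact/eqP.
  by apply/allpairsP; exists (s, i); rewrite mem_undup sL mem_enum.
rewrite -fsbig_seq ?filter_uniq // big_filter.
rewrite big_mkcond big_allpairs_dep /= /chain_of_list big_allpairs_dep /=.
under eq_bigr do rewrite big_enum -big_mkcond /=.
under [RHS]eq_bigr do rewrite big_enum /=.
have e s : \sum_(i | pB (s, i)) \sum_(x <- L) (x == s)%:R =
    (\sum_(x <- L) (x == s)%:R) * \sum_i ((s \o coface i) == t)%:R :> 'F_2.
  rewrite big_mkcond mulr_sumr; apply: eq_bigr => i _; rewrite /pB /=.
  by case: eqP => _; rewrite ?mulr1 ?mulr0.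
under eq_bigr do rewrite e mulr_suml.
rewrite exchange_big /=; apply: eq_big_seq => s sL.
rewrite (bigD1_seq s) ?mem_undup ?undup_uniq //= eqxx mul1r [X in _ + X]big1 ?addr0 // => y.
by rewrite eq_sym => /negPf->; rewrite mul0r.
Qed.

End SingularLists.

Section Extension.
Variables (R : realType) (k : nat).
Local Notation W := ('rV[R]_k).
Local Open Scope classical_set_scope.

(** Subdivisions consist of points of the ambient vector space, whereas a singular simplex is
    defined on a subtype; the value 0 outside is only a default. *)
Definition ext n (s : @std_simplex R n -> W) : 'rV[R]_n.+1 -> W := valL_ (0 : W) s.

Lemma extE n (s : @std_simplex R n -> W) (x : @std_simplex R n) : ext s (set_val x) = s x.
Proof. by have /(congr1 (fun f => f x)) := valLK (0 : W) s. Qed.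

Lemma ext_in n (s : @std_simplex R n -> W) x : std_simplex x ->
  exists2 y : @std_simplex R n, set_val y = x & ext s x = s y.
Proof.
move=> Sx; pose y : @std_simplex R n := exist _ x (mem_set Sx).
by exists y; rewrite // -[x in ext s x]/(set_val y) extE.
Qed.

Lemma ext_coface n (s : @std_simplex R n.+1 -> W) i x : std_simplex x ->
  ext (s \o coface i) x = ext s (insert0 i x).
Proof.
by move=> Sx; have [y <- ->] := ext_in (s \o coface i) Sx; exact: esym (extE s (coface i y)).
Qed.

Lemma ext_continuous n (s : @std_simplex R n -> W) :
  continuous s -> {within @std_simplex R n, continuous (ext s)}.
Proof. by move=> sc; apply/subspace_valL_continuousP'. Qed.

Lemma compact_std_simplex n : compact (@std_simplex R n).
Proof.
have -> : @std_simplex R n = @cross_sphere R n `&` \bigcap_(j in [set: 'I_n.+1]) [set x : 'rV[R]_n.+1 | 0 <= x 0 j].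
  apply/seteqP; split=> x /=.
    case=> x0 x1; split=> [|j _]; last exact: x0.
    by rewrite /cross_sphere /= -[RHS]x1; apply: eq_bigr => j _; rewrite ger0_norm.
  case=> xS x0; split=> [j|]; first exact: x0.
  by rewrite -[RHS]xS; apply: eq_bigr => j _; rewrite ger0_norm //; apply: x0.
apply: compact_closedI; first exact: compact_cross_sphere.
apply: closed_bigI => j _.
have -> : [set x : 'rV[R]_n.+1 | 0 <= x 0 j] = (fun x => x 0 j) @^-1` [set t | 0 <= t] by [].
apply: preimage_closed; last exact: closed_ge.
by move=> x _; exact: coord_continuous.
Qed.

End Extension.

Lemma sum_facets (T : Type) m (f : 'I_m.+1 -> T) (G : seq T -> 'F_2) :
  \sum_(w <- facets [seq f j | j <- enum 'I_m.+1]) G w =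
  \sum_i G [seq f (lift i j) | j <- enum 'I_m].
Proof.
elim: m f G => [|m IH] f G.
  by rewrite enum_ordSl (size0nil (size_enum_ord 0)) /= big_seq1 big_ord1.
rewrite enum_ordSl [map _ _]/= big_cons -map_comp big_map.
rewrite (IH (f \o lift ord0) (fun w => G (f ord0 :: w))) [RHS]big_ord_recl; congr (_ + _).
apply: eq_bigr => i _; rewrite enum_ordSl /= -map_comp.
by congr (G (f _ :: _)); [apply/val_inj | apply: eq_map => j; congr f; apply/val_inj; rewrite /= /bump /=; lia].
Qed.

Section FacetsOfFaces.
Import boot.fintype boot.finset.

Lemma facets_uniq (T : eqType) (l : seq T) (G : seq T -> 'F_2) : uniq l ->
  \sum_(w <- facets l) G w = \sum_(v <- l) G (seq.filter (predC1 v) l).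
Proof.
elim: l G => [|x l IH] G; first by rewrite !big_nil.
move=> /= /andP[xl ul]; rewrite !big_cons big_map eqxx /=; congr (G _ + _).
  by apply/esym/all_filterP/allP => y yl /=; apply: contraNneq xl => <-.
rewrite (IH (fun w => G (x :: w)) ul); apply: eq_big_seq => v vl.
by rewrite (_ : x != v) //; apply: contraNneq xl => ->.
Qed.

Variable V : finType.

Lemma sum_facets_enum (s : {set V}) (G : seq V -> 'F_2) :
  \sum_(w <- facets (enum s)) G w = \sum_(v in s) G (enum (s :\ v)).
Proof.
rewrite facets_uniq ?enum_uniq // big_enum /=; apply: eq_bigr => v _.
congr G; rewrite /enum_mem -filter_predI; apply: eq_filter => u /=.
by rewrite !inE.
Qed.

(** Both sides run over pairs of a set and one of its elements, exchanged by [s :\ v] and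
    [v |: s]. *)
Lemma sum_bd (z : {set V} -> 'F_2) (G : seq V -> 'F_2) :
  \sum_s bd z s * G (enum s) = \sum_s z s * \sum_(w <- facets (enum s)) G w.
Proof.
under [RHS]eq_bigr do rewrite sum_facets_enum mulr_sumr.
under [LHS]eq_bigr do rewrite /bd mulr_suml.
rewrite (exchange_big_dep predT) //= [RHS](exchange_big_dep predT) //=.
apply: eq_bigr => v _.
rewrite (reindex_onto (fun s => s :\ v) (fun s => v |: s)) /=; last first.
  by move=> s vs; rewrite setU1K.
apply: eq_big => [s|s /andP[_ /eqP ->]] //.
by rewrite !inE eqxx /=; apply/eqP/idP => [<-|/setD1K//]; rewrite setU11.
Qed.

End FacetsOfFaces.

Section Convex.
Variables (R : realType) (V : finType).

Lemma average_gt (w h : V -> R) (a : R) : (forall v, 0 <= w v) -> \sum_v w v = 1 ->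
  (forall v, w v != 0 -> a < h v) -> a < \sum_v w v * h v.
Proof.
move=> w0 w1 wh; rewrite -subr_gt0 -[a]mul1r -w1 mulr_suml -sumrB.
have [v wv] : exists v, w v != 0.
  apply/existsP; apply: contraT => /existsPn wz; move/eqP: w1.
  by rewrite big1 ?(eq_sym 0) ?oner_eq0 // => v _; apply/eqP; have := wz v; rewrite negbK.
rewrite (bigD1 v) //=; apply: ltr_pwDl.
  by rewrite -mulrBr mulr_gt0 ?subr_gt0 ?wh // lt_neqAle eq_sym wv w0.
apply: sumr_ge0 => u _; rewrite -mulrBr.
have [->|wu] := eqVneq (w u) 0; first by rewrite mul0r.
by rewrite mulr_ge0 ?subr_ge0 // ltW // wh.
Qed.

Lemma average_le (w h : V -> R) (a : R) : (forall v, 0 <= w v) -> \sum_v w v = 1 ->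
  (forall v, w v != 0 -> h v <= a) -> \sum_v w v * h v <= a.
Proof.
move=> w0 w1 wh; rewrite -[leRHS]mul1r -w1 mulr_suml; apply: ler_sum => v _.
have [->|wv] := eqVneq (w v) 0; first by rewrite !mul0r.
by rewrite ler_wpM2l // wh.
Qed.

End Convex.

(** * Simplicial chains as singular chains *)

Section SimplicialToSingular.
Import boot.fintype boot.finset.
Variables (R : realType) (V : finType) (k : nat) (p : V -> 'rV[R]_k) (v0 : V).
Local Notation W := ('rV[R]_k).

Definition affine_simplex n (q : 'I_n.+1 -> V) (x : @std_simplex R n) : W :=
  \sum_j set_val x 0 j *: p (q j).

Definition face_simplex n (l : seq V) : @std_simplex R n -> W :=
  affine_simplex (fun j : 'I_n.+1 => nth v0 l j).

(** Ordering every face by [enum] is coherent: deleting a vertex from a face deletes it from the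
    list, so facets are again faces in their own order. *)
Definition simp_chain n (z : {set V} -> 'F_2) : seq (@std_simplex R n -> W) :=
  [seq face_simplex (enum s) | s : {set V} <- enum [pred s : {set V} | z s != 0]].

Lemma affine_simplex_coface n (q : 'I_n.+2 -> V) i :
  affine_simplex q \o coface i = affine_simplex (fun j => q (lift i j)).
Proof.
apply/funext => x; rewrite /affine_simplex /= (bigD1_ord i) //=.
rewrite /coface set_valE /= mxE unlift_none scale0r add0r; apply: eq_bigr => j _.
by rewrite mxE liftK.
Qed.

Lemma sum_simp_chain n z (G : (@std_simplex R n -> W) -> 'F_2) :
  \sum_(x <- simp_chain n z) G x = \sum_s z s * G (face_simplex (enum s)).
Proof.
rewrite big_map big_enum /= big_mkcond; apply: eq_bigr => s _.
by rewrite inE; case: (eqVneq (z s) 0) => [->|/F2_neq0->]; rewrite ?mul0r ?mul1r.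
Qed.

Lemma sum_coface n (s : {set V}) (G : (@std_simplex R n -> W) -> 'F_2) : #|s| = n.+2 ->
  \sum_(i < n.+2) G (face_simplex (n := n.+1) (enum s) \o coface i) =
  \sum_(w <- facets (enum s)) G (face_simplex w).
Proof.
move=> cs; have es : enum s = [seq nth v0 (enum s) j | j : 'I_n.+2 <- enum 'I_n.+2].
  rewrite -[LHS](mkseq_nth v0) -cardE cs /mkseq -val_enum_ord -map_comp.
  exact: eq_map.
rewrite [in RHS]es sum_facets; apply: eq_bigr => i _.
rewrite affine_simplex_coface; congr G; congr affine_simplex; apply/funext => j.
by rewrite (nth_map j) ?size_enum_ord // nth_ord_enum.
Qed.

Lemma singular_bd_simp n (z : {set V} -> 'F_2) : (forall s : {set V}, z s != 0 -> #|s| = n.+2) ->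
  singular_bd (chain_of_list (simp_chain n.+1 z)) = chain_of_list (simp_chain n (bd z)).
Proof.
move=> zn; rewrite singular_bd_list; apply/funext => t; rewrite /chain_of_list.
rewrite big_allpairs_dep /= !sum_simp_chain.
rewrite (sum_bd z (fun w => (face_simplex w == t :> (@std_simplex R n -> W))%:R)).
apply: eq_bigr => s _; have [->|/zn cs] := eqVneq (z s) 0; first by rewrite !mul0r.
by rewrite big_enum /=; congr (_ * _); exact: (sum_coface (fun x => (x == t)%:R) cs).
Qed.

Variable C : {set {set V}}.
Hypothesis CC : simplicial_complex C.

Lemma dot_linear_ext (w : {ptws V -> R}) d : dot (linear_ext p w) d = \sum_v w v * dot (p v) d.
Proof.
rewrite /linear_ext; elim/big_rec2: _ => [|v x y _ IH].
  by rewrite /dot big1 // => j _; rewrite mxE mul0r.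
by rewrite dotDl dotZl IH.
Qed.

Lemma face_simplexE n (s : {set V}) (x : @std_simplex R n) : s \in C -> #|s| = n.+1 ->
  exists w : {ptws V -> R}, [/\ underlying_space C w, linear_ext p w = face_simplex (enum s) x &
    forall v, w v != 0 -> exists2 j : 'I_n.+1, v = nth v0 (enum s) j & set_val x 0 j != 0].
Proof.
move=> sC cs; have [x0 x1] := set_valP x.
pose q (j : 'I_n.+1) := nth v0 (enum s) j.
pose w : {ptws V -> R} := fun v => \sum_j set_val x 0 j * (v == q j)%:R.
have w0 v : 0 <= w v by apply: sumr_ge0 => j _; rewrite mulr_ge0.
have wq v : w v != 0 -> exists2 j : 'I_n.+1, v = q j & set_val x 0 j != 0.
  move=> wv; have /existsP[j /andP[/eqP vj xj]] : [exists j, (v == q j) && (set_val x 0 j != 0)].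
    apply: contraNT wv => /existsPn nj; apply/eqP/big1 => j _; have := nj j.
    by case: eqP => _ /=; rewrite ?mulr0 // negbK => /eqP->; rewrite mul0r.
  by exists j.
have w1 : \sum_v w v = 1.
  rewrite exchange_big /= -[RHS]x1; apply: eq_bigr => j _.
  by rewrite -mulr_sumr sum_eq1 mulr1.
exists w; split=> //.
- split=> //; apply: CC.2 sC _ _.
    apply/subsetP => v; rewrite inE => /wq[j -> _].
    by rewrite -mem_enum mem_nth // -cardE cs.
  have : \sum_v w v != 0 by rewrite w1 oner_eq0.
  apply: contraNneq => /setP wz; rewrite big1 // => v _.
  by have := wz v; rewrite !inE => /negbFE/eqP.
- rewrite /linear_ext /face_simplex /affine_simplex.
  under eq_bigr do rewrite scaler_suml.
  rewrite exchange_big /=; apply: eq_bigr => j _.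
  rewrite (bigD1 (q j)) //= eqxx mulr1 big1 ?addr0 // => v /negPf->.
  by rewrite mulr0 scale0r.
Qed.

Lemma singular_simplex_face n (s : {set V}) (A : set W) : s \in C -> #|s| = n.+1 ->
  (forall w, underlying_space C w -> (forall v, w v != 0 -> v \in s) -> A (linear_ext p w)) ->
  singular_simplex A (face_simplex (n := n) (enum s)).
Proof.
move=> sC cs HA; split.
  move=> x; apply: (@cvg_bigsum _ _ (nbhs x) (nbhs_filter x)) => j.
  apply: (@cvgZr_tmp _ _ _ (nbhs x) _ (fun y : @std_simplex R n => set_val y 0 j)).
  apply: (@cvg_comp _ _ _ (set_val : @std_simplex R n -> _) (fun y : 'rV[R]_n.+1 => y 0 j) (nbhs x) (nbhs (set_val x))).
    exact: initial_continuous.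
  exact: coord_continuous.
move=> _ [x _ <-]; have [w [wC <- ws]] := face_simplexE x sC cs.
apply: HA => // v /ws[j -> _].
by rewrite -mem_enum mem_nth // -cardE cs.
Qed.

End SimplicialToSingular.

(** * Sperner's lemma for iterated barycentric subdivisions *)

Section Sperner.
Import boot.fintype boot.finset.
Variables (R : realType) (V : finType) (n : nat).
Local Notation E := ('rV[R]_n.+1).

Definition vertices (J : seq 'I_n.+1) : seq E := [seq delta_mx 0 j | j <- J].

Definition std_face (J : seq 'I_n.+1) (x : E) :=
  std_simplex x /\ forall j, j \notin J -> x 0 j = 0.

Lemma bconvex_std_simplex : bconvex (@std_simplex R n).
Proof.
move=> l l0 lQ; split=> [j|].
  by apply: (@bconvex_ge0 _ _ (fun x : E => x 0 j)) => // [a x y|x /lQ[]//]; rewrite !mxE.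
apply: (@bconvex_eq _ _ (fun x : E => \sum_j x 0 j)) => // [a x y|x /lQ[]//].
by rewrite mulr_sumr -big_split; apply: eq_bigr => j _; rewrite !mxE.
Qed.

Lemma bconvex_std_face J : bconvex (std_face J).
Proof.
move=> l l0 lQ; split=> [|j jJ]; first by apply: bconvex_std_simplex => // x /lQ[].
apply: (@bconvex_eq _ _ (fun x : E => x 0 j)) => // [a x y|x /lQ[_ -> //]].
by rewrite !mxE.
Qed.

Lemma std_face_vertices J : {in vertices J, forall x, std_face J x}.
Proof.
move=> _ /mapP[j jJ ->]; split=> [|i iJ]; last first.
  by rewrite mxE eqxx /=; case: eqP => // ij; rewrite ij jJ in iJ.
split=> [i|]; first by rewrite mxE.
rewrite (bigD1 j) //= mxE !eqxx big1 ?addr0 // => i /negPf ij.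
by rewrite mxE ij andbF.
Qed.

Lemma sdk_std_face K J u : u \in sdk K (size J) (vertices J) ->
  size u = size J /\ {in u, forall x, std_face J x}.
Proof.
move=> uK; have [su uQ] := sdkP (size_map _ _) uK; split=> //.
by apply: uQ; [exact: bconvex_std_face | exact: std_face_vertices].
Qed.

Variables (label : E -> V) (q : 'I_n.+1 -> V).
Hypothesis labelP : forall x, std_simplex x -> exists2 j, label x = q j & x 0 j != 0.

Lemma label_face J x : std_face J x -> label x \in [set:: map q J].
Proof.
case=> /labelP[j -> xj] xJ; rewrite inE; apply: map_f.
by apply: contraNT xj => /xJ ->.
Qed.

Lemma spans_face K J u t : u \in sdk K (size J) (vertices J) ->
  spans (map label u) t != 0 -> #|t| = size J /\ t \subset [set:: map q J].
Proof.
move=> /sdk_std_face[su uJ] /spans_neq0[ct tu]; rewrite ct size_map; split=> //.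
by apply/subsetP => v /tu/mapP[x /uJ xJ ->]; exact: label_face.
Qed.

(** Induction on the face. Labels lie in [q] of [J], so a fully labelled simplex is detected by its
    facets labelled [t']. Summed mod 2, these are the ones on the subdivided boundary, and only the
    facet opposite to [j] can carry them: any other facet lacks a vertex other than [j]. *)
Lemma sperner K J : uniq (map q J) ->
  \sum_(u <- sdk K (size J) (vertices J)) spans (map label u) [set:: map q J] = 1.
Proof.
elim: J => [|j J IH] /=.
  by rewrite sdk_nil big_seq1 /spans eqxx.
move=> /andP[jJ uJ]; rewrite -[RHS](IH uJ).
set t' := [set:: map q J]; have jt' : q j \notin t' by rewrite inE.
have ct' : #|t'| = size J by rewrite cardsE (card_uniqP uJ) size_map.
transitivity (\sum_(u <- sdk K (size J).+1 (vertices (j :: J)))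
    dl (fun w => spans (map label w) t') u).
  apply: eq_big_seq => u uK.
  rewrite -[RHS](dl_map label (fun w => spans w t')) dl_spans /bd.
  rewrite (bigD1 (q j)) //= big1 ?addr0 => [|v /andP[vt' vj]].
    by congr spans; rewrite set_cons.
  apply/eqP; apply: contraNT vj => /(spans_face (J := j :: J) uK)[_ /subsetP/(_ v)].
  rewrite setU11 => /(_ isT); rewrite set_cons in_setU1 (negPf vt') orbF //.
rewrite sdk_chain ?size_map // big_cons -/(vertices J) [X in _ + X]big1_seq ?addr0 //.
move=> w /andP[_ /mapP[w' w'J ->]]; rewrite big1_seq // => u /andP[_ uK].
have {}w'J : w' \in facets (vertices J) := w'J.
move: w'J; rewrite facets_map => /mapP[J' J'J w'E].
have [sJ' J'sub] := facetsP J'J.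
have uK' : u \in sdk K (size (j :: J')) (vertices (j :: J')).
  by rewrite /= -sJ' /vertices /= -w'E.
apply/eqP; apply: contraT => /(spans_face uK')[_ t'J'].
have : t' \subset [set:: map q J'].
  apply/subsetP => v vt'; have := subsetP t'J' v vt'.
  by rewrite set_cons in_setU1 => /orP[/eqP vj|//]; rewrite -vj vt' in jt'.
move/subset_leq_card; rewrite ct' cardsE => /leq_trans/(_ (card_size _)).
by rewrite size_map sJ' ltnn.
Qed.

Lemma sum_spans_sdk K t : injective q ->
  \sum_(u <- sdk K n.+1 (vertices (enum 'I_n.+1))) spans (map label u) t =
  (t == [set:: map q (enum 'I_n.+1)])%:R.
Proof.
move=> qinj; have uq : uniq (map q (enum 'I_n.+1)) by rewrite map_inj_uniq ?enum_uniq.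
have := sperner K uq; rewrite size_enum_ord => sp.
case: eqVneq => [->//|tq]; rewrite big1_seq // => u /andP[_ uK].
apply/eqP; apply: contraNT tq => ut.
have uK' : u \in sdk K (size (enum 'I_n.+1)) (vertices (enum 'I_n.+1)) by rewrite size_enum_ord.
have [ct tsub] := spans_face uK' ut.
by rewrite eqEcard tsub ct cardsE (card_uniqP uq) size_map /=.
Qed.

End Sperner.

Lemma exists_uniform (R : realType) (T : eqType) (L : seq T) (Q : T -> R -> Prop) :
  (forall s d d', d' <= d -> Q s d -> Q s d') ->
  (forall s, s \in L -> exists2 d, 0 < d & Q s d) ->
  exists2 d, 0 < d & forall s, s \in L -> Q s d.
Proof.
move=> Qmono; elim: L => [|s L IH] LQ; first by exists 1.
have [|d d0 dL] := IH; first by move=> t tL; apply: LQ; rewrite inE tL orbT.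
have [d' d'0 d's] := LQ s (mem_head _ _).
exists (Num.min d d') => [|t]; first by rewrite lt_min d0.
rewrite inE => /orP[/eqP->|/dL]; last by apply: Qmono; rewrite ge_min lexx.
by apply: Qmono d's; rewrite ge_min lexx orbT.
Qed.

Section UnderlyingSpace.
Variables (R : realType) (V : finType) (k : nat) (p : V -> 'rV[R]_k).
Local Open Scope classical_set_scope.

Lemma continuous_linear_ext : continuous (linear_ext p).
Proof.
move=> w; apply: (@cvg_bigsum _ _ (nbhs w) (nbhs_filter w)) => v.
apply: (@cvgZr_tmp _ _ _ (nbhs w) _ (fun w' : {ptws V -> R} => w' v)).
exact: (@proj_continuous V (fun=> R) v w).
Qed.

Variable C : {set {set V}}.
Hypothesis CC : simplicial_complex C.

(** A finite union of compact images, one for each face without [v]. Off this set, points of the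
    embedded complex lie in the open star of [v]. *)
Lemma closed_opposite_faces v :
  closed (linear_ext p @` [set w | underlying_space C w /\ w v = 0]).
Proof.
pose box (s : {set V}) := [set w : {ptws V -> R} | forall u, (if u \in s then `[0, 1] else [set 0]) (w u)]
  `&` [set w | \sum_u w u = 1].
have cbox s : compact (box s).
  apply: compact_closedI.
    apply: (@tychonoff V (fun=> R) (fun u => if u \in s then `[0, 1] else [set 0])) => u.
    by case: ifP => _; [exact: segment_compact | exact: compact_set1].
  have -> : [set w : {ptws V -> R} | \sum_u w u = 1] = (fun w => \sum_u w u) @^-1` [set 1] by [].
  apply: preimage_closed; last exact: (@closed_eq R 1).
  move=> w _; apply: (@cvg_bigsum _ _ (nbhs w) (nbhs_filter w)) => u.
  exact: (@proj_continuous V (fun=> R) u w).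
have -> : linear_ext p @` [set w | underlying_space C w /\ w v = 0] =
    \bigcup_(s in [set s | s \in C /\ v \notin s]) linear_ext p @` box s.
  apply/seteqP; split=> [_ [w [[w0 w1 wC] wv] <-]|y [s [sC vs] [w [ws w1] <-]]].
    exists [set u | w u != 0]%SET; first by split=> //; rewrite inE wv eqxx.
    exists w => //; split=> // u; rewrite inE; case: eqVneq => [->|_] //=.
    rewrite in_itv /= w0 -w1 (bigD1 u) //= lerDl; exact: sumr_ge0.
  have w0 u : 0 <= w u.
    by have := ws u; case: ifP => _ /=; [rewrite in_itv => /andP[] | move=> ->].
  have wsub u : w u != 0 -> u \in s.
    by apply: contraNT => us; have := ws u; rewrite (negPf us) /= => ->.
  exists w => //; split; last by have := ws v; rewrite (negPf vs).
  split=> //; apply: CC.2 sC _ _.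
    by apply/fintype.subsetP => u; rewrite inE => /wsub.
  have : \sum_u w u != 0 by rewrite w1 oner_eq0.
  apply: contraNneq => /finset.setP wz; rewrite big1 // => u _.
  by have := wz u; rewrite !inE => /negbFE/eqP.
apply: closed_bigcup => [|s _]; first exact: finite_finset.
apply: compact_closed; first exact: norm_hausdorff.
apply: continuous_compact (cbox s); apply: continuous_subspaceT.
exact: continuous_linear_ext.
Qed.

Lemma compact_ranges n (L : seq (@std_simplex R n -> 'rV[R]_k)) :
  (forall s, s \in L -> continuous s) ->
  compact [set y | exists2 s, s \in L & range s y].
Proof.
elim: L => [|s L IH] Lc.
  by rewrite (_ : [set y | _] = set0); [exact: compact0 | apply/seteqP; split=> // y []].
rewrite (_ : [set y | _] = range s `|` [set y | exists2 s, s \in L & range s y]); last first.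
  apply/seteqP; split=> [y [t]|y [ys|[t tL yt]]].
  - by rewrite inE => /orP[/eqP->|tL yt]; [left | right; exists t].
  - by exists s; rewrite // inE eqxx.
  - by exists t; rewrite // inE tL orbT.
apply: compactU; last by apply: IH => t tL; apply: Lc; rewrite inE tL orbT.
have -> : range s = ext s @` @std_simplex R n.
  apply/seteqP; split=> [_ [x _ <-]|_ [x Sx <-]].
    by exists (set_val x); [exact: set_valP | rewrite extE].
  by have [y _ ->] := ext_in s Sx; exists y.
apply: continuous_compact; last exact: compact_std_simplex.
by apply: ext_continuous; apply: Lc; rewrite inE eqxx.
Qed.

End UnderlyingSpace.

(** * Simplicial approximation of singular simplices *)

Section Approximation.
Import boot.fintype boot.finset.
Variables (R : realType) (V : finType) (k : nat).
Local Notation W := ('rV[R]_k).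
Variables (label : W -> V) (K : nat).

(* The simplicial approximation of [s]: the simplices spanned by the labels in
   its iterated subdivision. *)
Definition approx n (s : @std_simplex R n -> W) (t : {set V}) : 'F_2 :=
  \sum_(u <- sdk K n.+1 (vertices R (enum 'I_n.+1))) spans (map (label \o ext s) u) t.

Lemma insert0_linear n (i : 'I_n.+2) : linear (@insert0 R n i).
Proof.
move=> a x y; apply/rowP => j; rewrite !mxE.
by case: unliftP => [j' _|_]; rewrite ?mxE // mulr0 addr0.
Qed.

Lemma insert0_delta n (i : 'I_n.+2) j : insert0 i (delta_mx 0 j) = delta_mx 0 (lift i j) :> 'rV[R]_n.+2.
Proof.
apply/rowP => l; rewrite !mxE eqxx /=; case: unliftP => [l' ->|->].
  by rewrite mxE eqxx (inj_eq lift_inj).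
by rewrite (negPf (neq_lift _ _)).
Qed.

Lemma vertices_std n J : {in vertices R J, forall x, @std_simplex R n x}.
Proof. by move=> x /std_face_vertices[]. Qed.

Lemma sdk_std n u : u \in sdk K n.+1 (vertices R (enum 'I_n.+1)) ->
  size u = n.+1 /\ {in u, forall x, @std_simplex R n x}.
Proof.
have := @sdk_std_face R n K (enum 'I_n.+1) u.
by rewrite size_enum_ord => uP /uP[su uS]; split=> // x /uS[].
Qed.

(** Subdivision is a chain map and commutes with the linear face inclusions [insert0 i], so
    approximation is a chain map. *)
Lemma bd_approx n (s : @std_simplex R n.+1 -> W) t :
  bd (approx s) t = \sum_i approx (s \o coface i) t.
Proof.
pose ins (i : 'I_n.+2) : {linear 'rV[R]_n.+1 -> 'rV[R]_n.+2} :=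
  HB.pack (insert0 i) (GRing.isLinear.Build _ _ _ _ _ (insert0_linear i)).
have -> : bd (approx s) t = \sum_(u <- sdk K n.+2 (vertices R (enum 'I_n.+2)))
    dl (fun w => spans (map (label \o ext s) w) t) u.
  rewrite /bd exchange_big /=; apply: eq_bigr => u _.
  by rewrite -[RHS](dl_map _ (fun w => spans w t)) dl_spans.
have sV : size (vertices R (enum 'I_n.+2)) = n.+2 by rewrite size_map size_enum_ord.
rewrite (sdk_chain _ _ sV) /vertices sum_facets; apply: eq_bigr => i _.
have -> : [seq delta_mx 0 (lift i j) | j <- enum 'I_n.+1] = map (ins i) (vertices R (enum 'I_n.+1)).
  by rewrite /vertices -[RHS]map_comp; apply: eq_map => j /=; rewrite insert0_delta.
rewrite sdk_map big_map; apply: eq_big_seq => u uK.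
rewrite -map_comp; congr spans; apply/eq_in_map => x xu /=.
by rewrite ext_coface //; apply: (sdk_std uK).2.
Qed.

End Approximation.

Section TightSimplicial.
Import boot.fintype boot.finset.
Variables (R : realType) (V : finType) (k : nat) (p : V -> 'rV[R]_k) (C : {set {set V}}).
Hypotheses (CC : simplicial_complex C) (Cp : linear_embedding C p).
Local Notation W := ('rV[R]_k).
Local Open Scope classical_set_scope.

(* Label each point [y] by a vertex above [a] whose open star contains a
   neighbourhood of [y] of uniform size.  Applied to a fine subdivision of a
   singular chain with boundary [z], simplicial approximation gives a simplicial
   chain with boundary [z], since it fixes [z] by Sperner's lemma. *)
Lemma tight_cycles_bound (d : W) (a : R) : dir_tight (embedded_space C p) d ->
  cycles_bound (superlevel C (fun v => dot (p v) d) a) C.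
Proof.
move=> tightd m z b zK bz bC bdb.
have [[s0 zs0]|z0] := pselect (exists s, z s != 0); last first.
  have zE s : z s = 0 by apply/eqP; apply: contra_notT z0 => zs; exists s.
  exists (fun=> 0) => [s|t]; first by rewrite eqxx.
  by rewrite zE /bd big1.
have /set0Pn[v0 _] : s0 != finset.set0.
  by rewrite -card_gt0; have := zK s0 zs0; rewrite mem_faces => /andP[_ /eqP->].
set h := fun v => dot (p v) d in zK *; set X := embedded_space C p in tightd *.
pose A := open_halfspace d a `&` X.
have zc s : z s != 0 -> #|s| = m.+1 by move=> /zK; rewrite mem_faces => /andP[_ /eqP].
have bc s : b s != 0 -> #|s| = m.+2 by move=> /bC; rewrite mem_faces => /andP[_ /eqP].
pose Z := simp_chain p v0 m z.
have ZA s : s \in Z -> singular_simplex A s.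
  move=> /mapP[t + ->]; rewrite mem_enum inE => zt.
  have := zK t zt; rewrite mem_faces inE => /andP[/andP[tC /forallP tup] _].
  apply: (singular_simplex_face v0 CC tC (zc t zt)).
  move=> w wC wt; split; last by exists w.
  rewrite /open_halfspace /= dot_linear_ext; have [w0 w1 _] := wC.
  by apply: average_gt => // v /wt vt; exact: (implyP (tup v)).
have bX s : s \in simp_chain p v0 m.+1 b -> singular_simplex X s.
  move=> /mapP[t + ->]; rewrite mem_enum inE => bt.
  have := bC t bt; rewrite mem_faces => /andP[tC _].
  apply: (singular_simplex_face v0 CC tC (bc t bt)).
  by move=> w wC _; exists w.
have cyc : singular_cycle A (chain_of_list Z).
  split; first exact: singular_chain_of_list.
  rewrite /Z; case: m zK bC zc {bc} => [//|m] zK bC zc in Z ZA bX *.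
  rewrite singular_bd_simp //; apply/funext => t.
  rewrite /chain_of_list sum_simp_chain big1 // => s _.
  rewrite [bd z s](_ : _ = 0) ?mul0r //.
  have [->|] := eqVneq s finset.set0; last exact: bz.
  by apply: (bd_supported0 zK); rewrite cards0.
have bnd : singular_boundary X (chain_of_list Z).
  exists (chain_of_list (simp_chain p v0 m.+1 b)); first exact: singular_chain_of_list.
  by rewrite singular_bd_simp //; congr chain_of_list; congr simp_chain; apply/funext.
have [b' [b'fin b'A] b'z] := tightd a m _ cyc bnd.
have [L b'E Lb'] := finite_chain_list b'fin.
have LA s : s \in L -> singular_simplex A s by move=> /Lb' /b'A.
have LZ y : \sum_(x <- [seq s \o coface i | s <- L, i <- enum 'I_m.+2]) (x == y)%:R =
    \sum_(x <- Z) (x == y)%:R :> 'F_2.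
  by have := congr1 (fun c => c y) b'z; rewrite b'E singular_bd_list.
(* The simplices of [Z] are included because labels must also be valid on them for Sperner's
   lemma. *)
pose Kc := [set y | exists2 s, s \in L & range s y] `|` [set y | exists2 s, s \in Z & range s y].
have cKc : compact Kc.
  by apply: compactU; apply: compact_ranges => s; [move=> /LA[] | move=> /ZA[]].
have KcA : Kc `<=` A.
  by move=> y [] [s]; [move=> /LA[_ sA] ys | move=> /ZA[_ sA] ys]; exact: sA.
pose P v y := a < h v /\ forall w, underlying_space C w -> linear_ext p w = y -> w v != 0.
have [x Kx|e e0 eP] := @lebesgue_number _ _ Kc _ P cKc _.
  have [xd [w wC wx]] := KcA x Kx.
  have xa : a < \sum_v w v * h v by rewrite -dot_linear_ext wx; exact: xd.
  (* The height of [x] is the average of the heights of the vertices carrying it, so one of these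
     lies above [a]. *)
  have [v wv hv] : exists2 v, w v != 0 & a < h v.
    have [v] : exists v, (w v != 0) && (a < h v).
      apply/existsP; apply: contraLR xa => /existsPn nv; rewrite -leNgt.
      have [w0 w1 _] := wC; apply: average_le => // v wv.
      by have := nv v; rewrite wv /= -leNgt.
    by case/andP; exists v.
  have Fx : ~ (linear_ext p @` [set w | underlying_space C w /\ w v = 0]) x.
    move=> [w' [w'C w'v] w'x]; case/eqP: wv.
    by have <- : w' = w by apply: Cp; [exact: mem_set | exact: mem_set | rewrite w'x wx].
  have := @closed_opposite_faces R V k p C CC v; rewrite -openC openE => /(_ x Fx) /nbhs_ballP[r /= r0 rF].
  exists v, r; split=> // y _ xy; split=> // w' w'C w'y.
  apply: contraPneq (rF y _) => [w'v|]; last by rewrite -ball_normE.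
  by apply; exists w'.
have /choice[label labelP] : forall x, exists v, Kc x -> forall y, Kc y -> `|x - y| < e -> P v y.
  move=> x; have [/eP[v vP]|nK] := pselect (Kc x); first by exists v.
  by exists v0.
(* Uniform continuity with a free center [y]: images of nearby points lie within [e / 2] of [y],
   hence within [e] of each other. *)
pose Q (s : @std_simplex R m.+1 -> W) (r : R) := forall x, @std_simplex R m.+1 x -> exists y,
  forall x', @std_simplex R m.+1 x' -> `|x - x'| < r -> `|ext s x' - y| < e / 2.
have [|s sL|r r0 rQ] := @exists_uniform _ _ L Q.
- move=> s r r' r'r sQ x Sx; have [y yP] := sQ x Sx; exists y => x' Sx' xx'.
  by apply: yP => //; exact: lt_le_trans r'r.
- have [sc _] := LA s sL.
  have := @lebesgue_number _ _ _ _ (fun (y : W) x => `|ext s x - y| < e / 2) (@compact_std_simplex R m.+1).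
  apply.
  move=> x Sx; exists (ext s x).
  have /subspace_continuousP/(_ x Sx)/cvgrPdist_lt/(_ (e / 2)) := ext_continuous sc.
  rewrite divr_gt0 // => /(_ isT) /nbhs_ballP[r /= r0 rP]; exists r; split=> // y Sy xy.
  by rewrite distrC; apply: rP => //; rewrite -ball_normE.
have [N NP] := @sdk_small R 'rV[R]_m.+2 m.+2 2 r (ler0n _ 2) r0.
have small u : u \in sdk N m.+2 (vertices R (enum 'I_m.+2)) ->
    [/\ size u = m.+2, {in u, forall x, @std_simplex R m.+1 x} & {in u &, forall x y, `|x - y| < r}].
  move=> uN; have [su uS] := sdk_std uN; split=> //; apply: NP uN.
    by rewrite size_map size_enum_ord.
  have v1 x : x \in vertices R (enum 'I_m.+2) -> `|x| <= 1.
    move=> /vertices_std[x0 x1]; apply: cross_sphere_norm.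
    by rewrite /cross_sphere /= -[RHS]x1; apply: eq_bigr => j _; rewrite ger0_norm.
  by move=> x y /v1 x1 /v1 y1; rewrite (le_trans (ler_normB _ _)) // -[2]/(1 + 1) lerD.
exists (fun t => \sum_(s <- L) approx label N s t) => [t dt|t].
  have [s sL [u uN ut]] : exists2 s, s \in L & exists2 u, u \in sdk N m.+2 (vertices R (enum 'I_m.+2)) &
      spans (map (label \o ext s) u) t != 0.
    apply: contrapT => none; case/eqP: dt; rewrite big1_seq // => s /andP[_ sL].
    rewrite /approx big1_seq // => u /andP[_ uN]; apply/eqP.
    by apply: contra_notT none => ut; exists s => //; exists u.
  have [su uS ur] := small u uN; have [ct tu] := spans_neq0 ut.
  have inK x : @std_simplex R m.+1 x -> Kc (ext s x).
    by move=> Sx; left; exists s => //; have [y _ ->] := ext_in s Sx; exists y.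
  case: u su uS ur tu ct {uN ut} => [//|x0 u] su uS ur tu ct.
  have x0u : x0 \in x0 :: u by rewrite inE eqxx.
  have Sx0 := uS x0 x0u; have [y yP] := rQ s sL x0 Sx0.
  have near x x' : x \in x0 :: u -> x' \in x0 :: u -> `|ext s x - ext s x'| < e.
    move=> xu x'u; rewrite -(subrKA y) (splitr e).
    apply: le_lt_trans (ler_normD _ _) (ltrD _ _); first by apply: yP; [exact: uS | exact: ur].
    by rewrite distrC; apply: yP; [exact: uS | exact: ur].
  have [_ [w wC wx0]] := KcA _ (inK _ Sx0).
  (* All labels on a small simplex are vertices of the face that carries the single point
     [ext s x0], hence span a face of [C], and they lie above [a]. *)
  have tP v : v \in t -> a < h v /\ w v != 0.
    move=> /tu/mapP[x xu ->]; have [hv] := labelP _ (inK _ (uS x xu)) _ (inK _ Sx0) (near _ _ xu x0u).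
    by move=> /(_ w wC wx0).
  rewrite mem_faces ct size_map su eqxx andbT inE; apply/andP; split; last first.
    by apply/forallP => v; apply/implyP => /tP[].
  have [_ _ wS] := wC; apply: CC.2 wS _ _; last by rewrite -card_gt0 ct size_map su.
  by apply/subsetP => v /tP[_]; rewrite inE.
rewrite /bd exchange_big /=.
have -> : \sum_(s <- L) \sum_(v | v \notin t) approx label N s (v |: t) =
    \sum_(x <- [seq s \o coface i | s <- L, i <- enum 'I_m.+2]) approx label N x t.
  rewrite big_allpairs_dep /=; apply: eq_bigr => s _; rewrite big_enum /=.
  exact: bd_approx.
rewrite (parity_sum _ LZ) sum_simp_chain (bigD1 t) //=.
have approx_face s : z s != 0 -> approx label N (face_simplex p v0 (n := m) (enum s)) t = (t == s)%:R.
  move=> zs; have cs := zc s zs; have := zK s zs; rewrite mem_faces inE => /andP[/andP[sC _] _].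
  have es : [seq nth v0 (enum s) j | j : 'I_m.+1 <- enum 'I_m.+1] = enum s.
    rewrite -[RHS](mkseq_nth v0) -cardE cs /mkseq -val_enum_ord -map_comp.
    exact: eq_map.
  rewrite /approx (@sum_spans_sdk R V m _ (fun j => nth v0 (enum s) j)); last 2 first.
  - move=> x /(ext_in (face_simplex p v0 (enum s)))[y yx] /= ->.
    have [w [wC wy ws]] := face_simplexE p v0 CC y sC cs.
    have Ky : Kc (face_simplex p v0 (enum s) y).
      by right; exists (face_simplex p v0 (enum s)); [apply/mapP; exists s; rewrite // mem_enum inE | exists y].
    have [|_ /(_ w wC wy)] := labelP _ Ky _ Ky; first by rewrite subrr normr0.
    by move=> /ws[j -> yj]; exists j; rewrite // -yx.
  - move=> i j /eqP; rewrite nth_uniq ?enum_uniq // -?cardE ?cs // => /eqP ij.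
    exact/val_inj.
  rewrite es; congr (nat_of_bool (_ == _))%:R; apply/setP => v.
  by rewrite inE mem_enum.
rewrite [X in _ + X]big1 ?addr0 => [|s st].
  by have [->|zt] := eqVneq (z t) 0; rewrite ?mul0r // approx_face // eqxx mulr1.
by have [->|zs] := eqVneq (z s) 0; rewrite ?mul0r // approx_face // eq_sym (negPf st) mulr0.
Qed.

End TightSimplicial.

(** * From a tight embedding to perfection *)

Section Perfection.
Import boot.fintype boot.finset.
Variables (R : realType) (V : finType) (C : {set {set V}}).
Hypothesis CC : simplicial_complex C.
Local Open Scope classical_set_scope.

Lemma linear_embedding_vertices k (p : V -> 'rV[R]_k) u v : linear_embedding C p ->
  ([set u] \in C)%SET -> ([set v] \in C)%SET -> p u = p v -> u = v.
Proof.
move=> Cp uC vC puv; pose e u : {ptws V -> R} := fun v => (v == u)%:R.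
have eC w : ([set w] \in C)%SET -> underlying_space C (e w).
  move=> wC; apply: (underlying_spaceP wC) => [x|x|]; last exact: sum_eq1.
    by rewrite inE /e => ->.
  by rewrite inE /e => /negPf->.
have pe w : linear_ext p (e w) = p w.
  rewrite /linear_ext (bigD1 w) //= /e eqxx scale1r big1 ?addr0 // => x /negPf->.
  by rewrite scale0r.
have /(congr1 (fun f : {ptws V -> R} => f u)) : e u = e v.
  by apply: Cp; [exact/mem_set/eC | exact/mem_set/eC | rewrite !pe].
by rewrite /e eqxx; case: eqP => // _ /eqP; rewrite oner_eq0.
Qed.

Lemma tight_embedding_perfect k : surface_links C -> admits_tight_embedding R C k ->
  perfect C.
Proof.
move=> C4 [p [Cp Ctight]].
(* A direction not orthogonal to these differences gives distinct vertices distinct heights. *)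
pose pairs := enum [pred u : V * V | [&& [set u.1]%SET \in C, [set u.2]%SET \in C & u.1 != u.2]].
pose ds := [seq p u.1 - p u.2 | u <- pairs].
have ds0 : {in ds, forall d, d != 0}.
  move=> _ /mapP[[u v] + ->]; rewrite mem_enum inE /= => /and3P[uC vC uv].
  by rewrite subr_eq0; apply: contraNneq uv => /(linear_embedding_vertices Cp uC vC)->.
have [x [Nx dsx]] := generic_direction Ctight ds0.
have pair_ds u v : [set u]%SET \in C -> [set v]%SET \in C -> u != v -> dot (p u - p v) x != 0.
  by move=> uC vC uv; apply: dsx; apply/mapP; exists (u, v); rewrite // mem_enum inE /= uC vC.
apply: (tight_perfect (h := fun v => dot (p v) x)) => // [u v uC vC huv|a].
  apply/eqP; apply: contraT => uv; have := pair_ds u v uC vC uv.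
  by rewrite dotDl -scaleN1r dotZl huv mulN1r subrr eqxx.
(* The exceptional set contains only nonzero directions, so [x = 0] may occur. Then no two vertices
   are separated, [C] has no edge, and [b] is zero. *)
have [x0|x0] := eqVneq x 0; last first.
  apply: tight_cycles_bound => //; apply: contrapT => nt; apply: Nx; split=> //.
move=> m z b _ _ bC bdb.
have b0 s : b s = 0.
  apply/eqP; apply: contraT => /bC; rewrite mem_faces => /andP[sC /eqP cs].
  have [w winj ws] := @exists_injection _ s 2 (ltac:(by rewrite cs)).
  have wC i : [set w i]%SET \in C.
    apply: CC.2 sC _ _; rewrite ?sub1set //.
    by apply/set0Pn; exists (w i); rewrite inE.
  have := pair_ds _ _ (wC ord0) (wC ord_max).
  rewrite x0 (inj_eq winj) => /(_ isT); rewrite /dot big1 ?eqxx // => j _.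
  by rewrite [X in _ * X]mxE mulr0.
exists (fun=> 0) => [s|t]; first by rewrite eqxx.
by rewrite -bdb /bd !big1.
Qed.

Lemma linear_embedding_locally (p : V -> 'rV[R]_3) : linear_embedding C p ->
  locally_in_space3 (@underlying_space R V C).
Proof.
move=> Cp x _; exists [set: {ptws V -> R}]%classic, (linear_ext p); split=> //; first exact: openT.
  exact/continuous_subspaceT/continuous_linear_ext.
by rewrite classical_sets.setIT.
Qed.

Lemma triangulated_manifold_locally : triangulated_manifold R C 3 ->
  locally_in_space3 (@underlying_space R V C).
Proof.
move=> mC x /mC[U [W [Uop Ux _ [f [g [fc _ _ _ [gf _]]]]]]].
exists U, f; split=> // y y' /set_mem yU /set_mem y'U fy.
by rewrite -(gf y yU) fy gf.
Qed.

End Perfection.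

Theorem theorem1 (R : realType) :
  (forall (V : finType) (C : {set {set V}}),
     simplicial_complex C ->
     admits_tight_embedding R C 3 ->
     perfect C) /\
  (forall (V : finType) (C : {set {set V}}),
     simplicial_complex C ->
     triangulated_manifold R C 3 ->
     (exists k : nat, admits_tight_embedding R C k) ->
     perfect C).
Proof.
split=> V C CC.
  move=> Ctight; have [p [Cp _]] := Ctight.
  apply: (tight_embedding_perfect CC _ Ctight).
  exact/(locally_in_space3_surface_links CC)/(linear_embedding_locally Cp).
move=> mC [k Ctight]; apply: (tight_embedding_perfect CC _ Ctight).
exact/(locally_in_space3_surface_links CC)/(triangulated_manifold_locally mC).
Qed.
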